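(* Let $R\subseteq T_A$ be a bimodule of relations for a connected strongly graded $S$-ring $A$ such that $A^1$ and $R$ are projective as left $S$-modules. Let $D$ be the central extension of $A$ associated to a filtered map $\alpha:R\to T_A$. Then the corresponding sequence $({}^1M_*,\delta_* )$ (augmented by $\delta_0:M_0\to S$) is isomorphic to the sequence $$D\otimes R_D\xrightarrow{d_2'}D\otimes D^1\xrightarrow{d_1'}D\to S\to0 .$$ In particular, $\mathrm H_1({}^1M_* )=0$.
   Context: $S$ is an associative unital ring, $\otimes=\otimes_S$. A positively graded $S$-ring $A=\bigoplus_{n\ge0}A^n$ is connected if $A^0=S$ and strongly graded if $A^nA^m=A^{n+m}$. Shift: $X(d)^n=X^{n+d}$. $T_A:=T_S(A^1)$ is the tensor $S$-ring, $\pi_A:T_A\to A$ the canonical surjection (identity in degrees $0,1$), $I_A=\ker\pi_A$. A bimodule of relations for $A$ is a graded $S$-subbimodule $R$ of $I_A$ with $I_A=R\oplus(A^1I_A+I_AA^1)$. A filtered map $\alpha:R\to T_A$ is an $S$-bimodule map with $\alpha(R^n)\subseteq T_A^{\le n}$; $\alpha_i:R\to T_A$ is its component of degree $-i$ (on $R^n$ it is $\alpha$ followed by projection to $T_A^{n-i}$); by convention $\alpha_0$ is the inclusion. Put $\alpha_z:R\to T_A[z]$, $\alpha_z(r)=\sum_{i\ge0}\alpha_i(r)z^i$ ($z$ central of degree $1$), $P_z=\alpha_z(R)$. The central extension of $A$ associated to $\alpha$ is $D:=T_A[z]/\langle P_z\rangle$; one has $D^0=S$, $D^1=A^1\oplus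 Sz$, $D/zD\cong A$. Definition of $R_D$, $d_1'$, $d_2'$: let $T_D:=T_S(D^1)$, $\pi_D:T_D\to D$ the canonical surjection, $\zeta:T_A\to T_D$ the graded ring morphism induced by $A^1\subseteq D^1$, $\lambda:T_A[z]\to T_D$ the left $T_A$-linear map with $\lambda(z^n)=z^{\otimes n}$ for all $n$ (so $\lambda(tz^n)=\zeta(t)\otimes z^{\otimes n}$), and $[z,A^1]=\{z\otimes a-a\otimes z\mid a\in A^1\}\subseteq T_D^2$. Put $R_D:=\lambda(P_z)+[z,A^1]\subseteq T_D$. For an element $r$ of positive degree in $T_D$ write $r=\sum r_{T_D}\otimes r_{D^1}$ with $r_{T_D}\in T_D$, $r_{D^1}\in D^1$ (via $T_D^+\cong T_D\otimes D^1$), and similarly $r=\sum r_{T_A}\otimes r_{A^1}$ for $r\in T_A^+$. Then $d_1'(x\otimes y)=xy$, $d_2'(x\otimes r)=\sum x\,\pi_D(r_{T_D})\otimes r_{D^1}$, and $D\to S$ is the projection onto $D^0$. Definition of ${}^1M_*$: it is built from the beginning $A\otimes R\xrightarrow{d_2}A\otimes A^1\xrightarrow{d_1}A\to S\to 0$ of a projective resolution of $S$, where $d_1$ is multiplication and $d_2(a\otimes r)=\sum a\,\pi_A(r_{T_A})\otimes r_{A^1}$. With $\tilde\zeta=\pi_D\zeta:T_A\to D$ put $\partial_1(x\otimes a)=xa$ on $D\otimes A^1$ (with $A^1\subseteq D^1$), $\partial_2(x\otimes r)=\sum x\,\tilde\zeta(r_{T_A})\otimes r_{A^1}$ on $D\otimes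 R$, and $f_2(x\otimes r)=\sum_{i\ge1}x\,\tilde\zeta(\alpha_i(r))z^{i-1}$. Then ${}^1M_*$ is the complex of graded left $D$-modules $M_2\xrightarrow{\delta_2}M_1\xrightarrow{\delta_1}M_0\to0$ with $M_0=D$, $M_1=(D\otimes A^1)\oplus D(-1)$, $M_2=(D\otimes R)\oplus(D\otimes A^1)(-1)$, $\delta_1(x,y)=\partial_1(x)+zy$, $\delta_2(x,y)=(\partial_2(x)-zy,\ \partial_1(y)+f_2(x))$; $\delta_0:D\to S$ is the projection onto $D^0$. $\mathrm H_1({}^1M_* )=\ker\delta_1/\operatorname{im}\delta_2$. *)

(* Defs.v *)
From HB Require Import structures.
From mathcomp Require Import all_boot all_order all_algebra.
From mathcomp Require Import boolp classical_sets.

Set Implicit Arguments.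
Unset Strict Implicit.
Unset Printing Implicit Defensive.

Import GRing.Theory.
Local Open Scope classical_set_scope.
Local Open Scope ring_scope.
Local Open Scope quotient_scope.

HB.mixin Record Lmodule_isBimodule (B C : pzRingType) V
    of GRing.Lmodule B V := {
  rscale : V -> C -> V;
  rscaleDl : forall c, {morph rscale^~ c : x y / x + y};
  rscaleDr : forall x, {morph rscale x : c d / c + d};
  rscaleA : forall x c d, rscale (rscale x c) d = rscale x (c * d);
  rscale1 : forall x, rscale x 1 = x;
  rscaleAl : forall b x c, rscale (b *: x) c = b *: rscale x c }.

#[short(type="bimodType")]
HB.structure Definition Bimodule (B C : pzRingType) :=
  { V of GRing.Lmodule B V & Lmodule_isBimodule B C V }.

Notation "x :* s" := (rscale x s) : ring_scope.

Section BimoduleTheory.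
Variables (B C : pzRingType) (V : bimodType B C).

Lemma rscale0l (c : C) : (0 : V) :* c = 0.
Proof. by apply: (addrI (0 :* c)); rewrite -rscaleDl !addr0. Qed.

Lemma rscale0r (x : V) : x :* (0 : C) = 0.
Proof. by apply: (addrI (x :* 0)); rewrite -rscaleDr !addr0. Qed.

Lemma rscaleNl (x : V) (c : C) : (- x) :* c = - (x :* c).
Proof. by apply: (addrI (x :* c)); rewrite -rscaleDl !subrr rscale0l. Qed.

Lemma rscale_suml (I : Type) (r : seq I) (P : pred I) (F : I -> V) (c : C) :
  (\sum_(i <- r | P i) F i) :* c = \sum_(i <- r | P i) (F i :* c).
Proof.
exact: (big_morph (fun x : V => x :* c) (rscaleDl c) (rscale0l c)).
Qed.

End BimoduleTheory.

(* The ring E as a (B, C)-bimodule, by restriction along f and g. *)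
Definition bireg (B C E : pzRingType) (f : {rmorphism B -> E})
  (g : {rmorphism C -> E}) : Type := E.

Section Bireg.
Variables (B C E : pzRingType) (f : {rmorphism B -> E}) (g : {rmorphism C -> E}).

HB.instance Definition _ := GRing.Zmodule.on (bireg f g).

Fact bireg_scaleA b c (x : bireg f g) :
  f b * ((f c * (x : E)) : E) = f (b * c) * (x : E).
Proof. by rewrite rmorphM mulrA. Qed.
Fact bireg_scale1 (x : bireg f g) : f 1 * (x : E) = x.
Proof. by rewrite rmorph1 mul1r. Qed.
Fact bireg_scaleDr b (x y : bireg f g) :
  f b * ((x + y) : E) = f b * (x : E) + f b * (y : E).
Proof. exact: mulrDr. Qed.
Fact bireg_scaleDl (x : bireg f g) b c :
  f (b + c) * (x : E) = f b * (x : E) + f c * (x : E).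
Proof. by rewrite rmorphD mulrDl. Qed.

HB.instance Definition _ := GRing.Zmodule_isLmodule.Build B (bireg f g)
  bireg_scaleA bireg_scale1 bireg_scaleDr (fun x b c => bireg_scaleDl x b c).

Definition bireg_rscale (x : bireg f g) (c : C) : bireg f g := (x : E) * g c.

Fact bireg_rscaleDl c : {morph bireg_rscale^~ c : x y / x + y}.
Proof. by move=> x y; exact: mulrDl. Qed.
Fact bireg_rscaleDr x : {morph bireg_rscale x : c d / c + d}.
Proof. by move=> c d; rewrite /bireg_rscale rmorphD; exact: mulrDr. Qed.
Fact bireg_rscaleA x c d :
  bireg_rscale (bireg_rscale x c) d = bireg_rscale x (c * d).
Proof. by rewrite /bireg_rscale rmorphM mulrA. Qed.
Fact bireg_rscale1 x : bireg_rscale x 1 = x.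
Proof. by rewrite /bireg_rscale rmorph1 mulr1. Qed.
Fact bireg_rscaleAl b x c :
  bireg_rscale (b *: x) c = b *: bireg_rscale x c.
Proof. by rewrite /bireg_rscale; symmetry; exact: mulrA. Qed.

HB.instance Definition _ := Lmodule_isBimodule.Build B C (bireg f g)
  bireg_rscaleDl bireg_rscaleDr bireg_rscaleA bireg_rscale1 bireg_rscaleAl.
End Bireg.

Record subbimod (B C : pzRingType) (M : bimodType B C) := SubBimod {
  sbm_set :> M -> Prop;
  sbm0 : sbm_set 0;
  sbmB : forall x y, sbm_set x -> sbm_set y -> sbm_set (x - y);
  sbmZ : forall b x, sbm_set x -> sbm_set (b *: x);
  sbmR : forall c x, sbm_set x -> sbm_set (x :* c) }.

Section SubBimodule.
Variables (B C : pzRingType) (M : bimodType B C) (U : subbimod M).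

Definition sbm_pred : {pred M} := fun x => `[< U x >].

Record sbm_sort := SubElt { sbm_val :> M; sbm_valP : sbm_val \in sbm_pred }.

HB.instance Definition _ := [isSub for sbm_val].
HB.instance Definition _ := [Choice of sbm_sort by <:].

Fact sbm_pred_closed : GRing.submod_closed sbm_pred.
Proof.
split; first by apply/asboolP; exact: sbm0.
move=> b x y /asboolP Ux /asboolP Uy; apply/asboolP.
have Uny : U (- y) by rewrite -sub0r; apply: sbmB => //; exact: sbm0.
by rewrite -[y]opprK; apply: sbmB => //; exact: sbmZ.
Qed.
HB.instance Definition _ := GRing.isSubmodClosed.Build B M sbm_pred sbm_pred_closed.
HB.instance Definition _ := [SubChoice_isSubLmodule of sbm_sort by <:].

Definition sbm_elt (x : M) (Ux : U x) : sbm_sort := SubElt (asboolT Ux).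

Lemma sbm_mem (x : sbm_sort) : U (val x).
Proof. by case: x => x /= /asboolP. Qed.

Definition sbm_rscale (x : sbm_sort) (c : C) : sbm_sort :=
  sbm_elt (sbmR c (sbm_mem x)).

Fact sbm_rscaleDl c : {morph sbm_rscale^~ c : x y / x + y}.
Proof. by move=> x y; apply: val_inj; rewrite /= rscaleDl. Qed.
Fact sbm_rscaleDr x : {morph sbm_rscale x : c d / c + d}.
Proof. by move=> c d; apply: val_inj; rewrite /= rscaleDr. Qed.
Fact sbm_rscaleA x c d : sbm_rscale (sbm_rscale x c) d = sbm_rscale x (c * d).
Proof. by apply: val_inj; rewrite /= rscaleA. Qed.
Fact sbm_rscale1 x : sbm_rscale x 1 = x.
Proof. by apply: val_inj; rewrite /= rscale1. Qed.
Fact sbm_rscaleAl b x c : sbm_rscale (b *: x) c = b *: sbm_rscale x c.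
Proof. by apply: val_inj; rewrite /= rscaleAl. Qed.

HB.instance Definition _ := Lmodule_isBimodule.Build B C sbm_sort
  sbm_rscaleDl sbm_rscaleDr sbm_rscaleA sbm_rscale1 sbm_rscaleAl.
End SubBimodule.

Coercion sbm_bimod (B C : pzRingType) (M : bimodType B C) (U : subbimod M)
  : bimodType B C := sbm_sort U.

Definition projective (B : pzRingType) (P : lmodType B) : Prop :=
  forall (X Y : lmodType B) (p : {linear X -> Y}) (f : {linear P -> Y}),
    (forall y, exists x, p x = y) ->
    exists g : {linear P -> X}, forall u, p (g u) = f u.

(* M (x)_C N as formal sums of pairs, two sums being identified when every
   balanced map takes the same value on them: this is the kernel of the map
   to the tensor product, by its universal property. *)
Section Tensor.
Variables (B C D : pzRingType) (M : bimodType B C) (N : bimodType C D).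

Record balanced (G : zmodType) (b : M -> N -> G) : Prop := Balanced {
  balDl : forall y, {morph b^~ y : x x' / x + x'};
  balDr : forall x, {morph b x : y y' / y + y'};
  balA : forall x c y, b (x :* c) y = b x (c *: y) }.

Definition bal_eval (G : zmodType) (b : M -> N -> G) (s : seq (M * N)) : G :=
  \sum_(p <- s) b p.1 p.2.

Definition tens_eqv (s t : seq (M * N)) : bool :=
  `[< forall (G : zmodType) (b : M -> N -> G), balanced b ->
        bal_eval b s = bal_eval b t >].

Fact tens_eqv_refl : reflexive tens_eqv.
Proof. by move=> s; apply/asboolP. Qed.
Fact tens_eqv_sym : symmetric tens_eqv.
Proof. by move=> s t; apply/asboolP/asboolP => H G b bb; rewrite H. Qed.
Fact tens_eqv_trans : transitive tens_eqv.
Proof.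
by move=> t s u /asboolP st /asboolP tu; apply/asboolP => G b bb; rewrite st ?tu.
Qed.
Canonical tens_equiv :=
  EquivRel tens_eqv tens_eqv_refl tens_eqv_sym tens_eqv_trans.

Definition tens : Type := {eq_quot tens_equiv}.
HB.instance Definition _ := Choice.on tens.
HB.instance Definition _ := EqQuotient.on tens.

Definition tpure (x : M) (y : N) : tens := \pi_tens [:: (x, y)].

(* The map x (x) y |-> b x y; meaningful when b is balanced. *)
Definition tlift (G : zmodType) (b : M -> N -> G) (t : tens) : G :=
  bal_eval b (repr t).

Lemma tlift_pi (G : zmodType) (b : M -> N -> G) s :
  balanced b -> tlift b (\pi_tens s) = bal_eval b s.
Proof.
move=> bb; rewrite /tlift.
have /eqmodP/asboolP : \pi_tens (repr (\pi_tens s)) = \pi_tens s by rewrite reprK.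
exact.
Qed.

Lemma tens_pi_eq s t :
  (forall (G : zmodType) (b : M -> N -> G), balanced b ->
     bal_eval b s = bal_eval b t) -> \pi_tens s = \pi_tens t.
Proof. by move=> H; apply/eqmodP/asboolP. Qed.

Lemma tens_eqP (t u : tens) :
  (forall (G : zmodType) (b : M -> N -> G), balanced b ->
     tlift b t = tlift b u) -> t = u.
Proof. by move=> H; rewrite -[t]reprK -[u]reprK; apply: tens_pi_eq. Qed.

Definition tens_add (t u : tens) : tens := \pi_tens (repr t ++ repr u).
Definition tens_map (f : M -> M) (g : N -> N) (t : tens) : tens :=
  \pi_tens [seq (f p.1, g p.2) | p <- repr t].

Lemma tlift_add (G : zmodType) (b : M -> N -> G) t u : balanced b ->
  tlift b (tens_add t u) = tlift b t + tlift b u.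
Proof. by move=> bb; rewrite tlift_pi // /bal_eval big_cat. Qed.

Lemma tlift_map (G : zmodType) (b : M -> N -> G) f g t : balanced b ->
  tlift b (tens_map f g t) = tlift (fun x y => b (f x) (g y)) t.
Proof. by move=> bb; rewrite tlift_pi // /bal_eval big_map. Qed.

Lemma tlift_nil (G : zmodType) (b : M -> N -> G) : balanced b ->
  tlift b (\pi_tens [::]) = 0.
Proof. by move=> bb; rewrite tlift_pi // /bal_eval big_nil. Qed.

Lemma balN (G : zmodType) (b : M -> N -> G) x y : balanced b ->
  b (- x) y = - b x y.
Proof.
move=> bb; have b0 : b 0 y = 0.
  by apply: (addrI (b 0 y)); rewrite -(balDl bb) !addr0.
by apply: (addrI (b x y)); rewrite -(balDl bb) !subrr.
Qed.

Lemma tlift_opp (G : zmodType) (b : M -> N -> G) t : balanced b ->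
  tlift b (tens_map -%R id t) = - tlift b t.
Proof.
move=> bb; rewrite tlift_map // /tlift /bal_eval -sumrN.
by apply: eq_bigr => p _; rewrite balN.
Qed.

Fact tens_addA : associative tens_add.
Proof.
by move=> t u v; apply: tens_eqP => G b bb; rewrite !tlift_add // addrA.
Qed.
Fact tens_addC : commutative tens_add.
Proof.
by move=> t u; apply: tens_eqP => G b bb; rewrite !tlift_add // addrC.
Qed.
Fact tens_add0 : left_id (\pi_tens [::]) tens_add.
Proof.
by move=> t; apply: tens_eqP => G b bb; rewrite tlift_add // tlift_nil // add0r.
Qed.
Fact tens_addN : left_inverse (\pi_tens [::]) (tens_map -%R id) tens_add.
Proof.
move=> t; apply: tens_eqP => G b bb.
by rewrite tlift_add // tlift_opp // tlift_nil // addNr.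
Qed.
HB.instance Definition _ :=
  GRing.isZmodule.Build tens tens_addA tens_addC tens_add0 tens_addN.

Lemma tliftD (G : zmodType) (b : M -> N -> G) : balanced b ->
  {morph tlift b : t u / t + u}.
Proof. by move=> bb t u; exact: tlift_add. Qed.

Definition tens_scale (c : B) : tens -> tens := tens_map ( *:%R c) id.

Lemma bal_scale (G : zmodType) (b : M -> N -> G) (c : B) : balanced b ->
  balanced (fun x y => b (c *: x) y).
Proof.
move=> bb; split=> [y x x'|x y y'|x d y].
- by rewrite scalerDr (balDl bb).
- by rewrite (balDr bb).
- by rewrite -rscaleAl (balA bb).
Qed.

Fact tens_scaleA b c (t : tens) :
  tens_scale b (tens_scale c t) = tens_scale (b * c) t.
Proof.
apply: tens_eqP => G h bh; rewrite !tlift_map //; last exact: bal_scale.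
by apply: eq_bigr => p _; rewrite /= scalerA.
Qed.
Fact tens_scale1 : left_id 1 tens_scale.
Proof.
move=> t; apply: tens_eqP => G h bh; rewrite tlift_map //.
by apply: eq_bigr => p _; rewrite /= scale1r.
Qed.
Fact tens_scaleDr : right_distributive tens_scale +%R.
Proof.
move=> c t u; apply: tens_eqP => G h bh.
by rewrite tliftD // !tlift_map // tliftD //; exact: bal_scale.
Qed.
Fact tens_scaleDl (t : tens) : {morph tens_scale^~ t : b c / b + c}.
Proof.
move=> b c; apply: tens_eqP => G h bh.
rewrite tliftD // !tlift_map // /tlift /bal_eval -big_split.
by apply: eq_bigr => p _; rewrite /= scalerDl (balDl bh).
Qed.
HB.instance Definition _ := GRing.Zmodule_isLmodule.Build B tens
  tens_scaleA tens_scale1 tens_scaleDr tens_scaleDl.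

Definition tens_rscale (t : tens) (d : D) : tens :=
  tens_map id (fun y : N => y :* d) t.

Lemma bal_rscale (G : zmodType) (b : M -> N -> G) (d : D) : balanced b ->
  balanced (fun x y => b x (y :* d)).
Proof.
move=> bb; split=> [y x x'|x y y'|x c y].
- by rewrite (balDl bb).
- by rewrite rscaleDl (balDr bb).
- by rewrite rscaleAl (balA bb).
Qed.

Fact tens_rscaleDl d : {morph tens_rscale^~ d : t u / t + u}.
Proof.
move=> t u; apply: tens_eqP => G h bh.
by rewrite tliftD // !tlift_map // tliftD //; exact: bal_rscale.
Qed.
Fact tens_rscaleDr t : {morph tens_rscale t : c d / c + d}.
Proof.
move=> c d; apply: tens_eqP => G h bh.
rewrite tliftD // !tlift_map // /tlift /bal_eval -big_split.
by apply: eq_bigr => p _; rewrite /= rscaleDr (balDr bh).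
Qed.
Fact tens_rscaleA t c d :
  tens_rscale (tens_rscale t c) d = tens_rscale t (c * d).
Proof.
apply: tens_eqP => G h bh; rewrite !tlift_map //; last exact: bal_rscale.
by apply: eq_bigr => p _; rewrite /= rscaleA.
Qed.
Fact tens_rscale1 t : tens_rscale t 1 = t.
Proof.
apply: tens_eqP => G h bh; rewrite tlift_map //.
by apply: eq_bigr => p _; rewrite /= rscale1.
Qed.
Fact tens_rscaleAl b t d : tens_rscale (b *: t) d = b *: tens_rscale t d.
Proof.
apply: tens_eqP => G h bh; rewrite !tlift_map //; first exact: bal_scale.
exact: bal_rscale.
Qed.
HB.instance Definition _ := Lmodule_isBimodule.Build B D tens
  tens_rscaleDl tens_rscaleDr tens_rscaleA tens_rscale1 tens_rscaleAl.

Lemma tlift_pure (G : zmodType) (b : M -> N -> G) x y : balanced b ->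
  tlift b (tpure x y) = b x y.
Proof. by move=> bb; rewrite tlift_pi // /bal_eval big_seq1. Qed.

Lemma tens_scale_pure c x y : c *: tpure x y = tpure (c *: x) y.
Proof.
apply: tens_eqP => G b bb; rewrite [LHS]tlift_map // !tlift_pure //.
exact: bal_scale.
Qed.
Lemma tens_rscale_pure c x y : tpure x y :* c = tpure x (y :* c).
Proof.
apply: tens_eqP => G b bb; rewrite [LHS]tlift_map // !tlift_pure //.
exact: bal_rscale.
Qed.

Lemma balanced_tpure : balanced tpure.
Proof.
split=> [y x x'|x y y'|x c y]; apply: tens_eqP => G b bb;
  rewrite ?tliftD // !tlift_pure //.
- exact: balDl.
- exact: balDr.
- exact: balA.
Qed.

Lemma tens_sum (t : tens) : t = \sum_(p <- repr t) tpure p.1 p.2.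
Proof.
apply: tens_eqP => G b bb.
rewrite (big_morph (tlift b) (tliftD bb) (tlift_nil bb)) {1}/tlift.
by apply: eq_bigr => p _; rewrite tlift_pure.
Qed.

Lemma tens_ind (P : tens -> Prop) : P 0 ->
  (forall t u, P t -> P u -> P (t + u)) ->
  (forall x y, P (tpure x y)) -> forall t, P t.
Proof.
by move=> P0 PD Pp t; rewrite [t]tens_sum; elim/big_ind: _ => // p _; exact: Pp.
Qed.

End Tensor.

(* The tensor ring T_S(V), as the direct sum of the tensor powers of V. *)
Section TensorRing.
Variables (S : nzRingType) (V : bimodType S S).

Local Notation regS := (bireg (idfun : {rmorphism S -> S}) idfun).

Fixpoint tpow (n : nat) : bimodType S S :=
  if n is m.+1 then tens (tpow m) V else regS.

Definition tring_pred : {pred forall n, tpow n} :=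
  fun x => `[< exists N, forall n, (N <= n)%N -> x n = 0 >].

Record tring := TRing {
  tcoef :> forall n, tpow n;
  tcoefP : tcoef \in tring_pred }.

HB.instance Definition _ := [isSub for tcoef].
HB.instance Definition _ := [Choice of tring by <:].

Lemma tring_ext (x y : tring) : (forall n, x n = y n) -> x = y.
Proof. by move=> xy; apply: val_inj; exact: functional_extensionality_dep. Qed.

Lemma tring_bound (x : tring) : exists N, `[< forall n, (N <= n)%N -> x n = 0 >].
Proof.
by case: x => x /= /asboolP[N xN]; exists N; apply/asboolP => n /xN.
Qed.

(* One more than the top degree of x, and 0 for x = 0. *)
Definition tsize (x : tring) : nat := ex_minn (tring_bound x).

Lemma tsize_coef (x : tring) n : (tsize x <= n)%N -> x n = 0.
Proof. by rewrite /tsize; case: ex_minnP => N /asboolP xN _ /xN. Qed.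

Definition tmk (f : forall n, tpow n)
  (fP : exists N, forall n, (N <= n)%N -> f n = 0) : tring := TRing (asboolT fP).

Fact tzero_bound : exists N, forall n, (N <= n)%N -> (0 : tpow n) = 0.
Proof. by exists 0%N. Qed.
Definition tzero := tmk tzero_bound.

Fact tadd_bound (x y : tring) :
  exists N, forall n, (N <= n)%N -> x n + y n = 0.
Proof.
exists (maxn (tsize x) (tsize y)) => n; rewrite geq_max => /andP[xn yn].
by rewrite !tsize_coef // addr0.
Qed.
Definition tadd x y := tmk (tadd_bound x y).

Fact topp_bound (x : tring) : exists N, forall n, (N <= n)%N -> - x n = 0.
Proof. by exists (tsize x) => n xn; rewrite tsize_coef // oppr0. Qed.
Definition topp x := tmk (topp_bound x).

Fact taddA : associative tadd.
Proof. by move=> x y z; apply: tring_ext => n /=; rewrite addrA. Qed.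
Fact taddC : commutative tadd.
Proof. by move=> x y; apply: tring_ext => n /=; rewrite addrC. Qed.
Fact tadd0 : left_id tzero tadd.
Proof. by move=> x; apply: tring_ext => n /=; rewrite add0r. Qed.
Fact taddN : left_inverse tzero topp tadd.
Proof. by move=> x; apply: tring_ext => n /=; rewrite addNr. Qed.
HB.instance Definition _ := GRing.isZmodule.Build tring taddA taddC tadd0 taddN.

Fact tscale_bound (s : S) (x : tring) :
  exists N, forall n, (N <= n)%N -> s *: x n = 0.
Proof. by exists (tsize x) => n xn; rewrite tsize_coef // scaler0. Qed.
Definition tscale s x := tmk (tscale_bound s x).

Fact tscaleA s t (x : tring) : tscale s (tscale t x) = tscale (s * t) x.
Proof. by apply: tring_ext => n /=; rewrite scalerA. Qed.
Fact tscale1 : left_id 1 tscale.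
Proof. by move=> x; apply: tring_ext => n /=; rewrite scale1r. Qed.
Fact tscaleDr : right_distributive tscale +%R.
Proof. by move=> s x y; apply: tring_ext => n /=; rewrite scalerDr. Qed.
Fact tscaleDl (x : tring) : {morph tscale^~ x : s t / s + t}.
Proof. by move=> s t; apply: tring_ext => n /=; rewrite scalerDl. Qed.
HB.instance Definition _ := GRing.Zmodule_isLmodule.Build S tring
  tscaleA tscale1 tscaleDr tscaleDl.

Fact trscale_bound (x : tring) (s : S) :
  exists N, forall n, (N <= n)%N -> x n :* s = 0.
Proof. by exists (tsize x) => n xn; rewrite tsize_coef // rscale0l. Qed.
Definition trscale x s := tmk (trscale_bound x s).

Fact trscaleDl s : {morph trscale^~ s : x y / x + y}.
Proof. by move=> x y; apply: tring_ext => n /=; rewrite rscaleDl. Qed.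
Fact trscaleDr x : {morph trscale x : s t / s + t}.
Proof. by move=> s t; apply: tring_ext => n /=; rewrite rscaleDr. Qed.
Fact trscaleA x s t : trscale (trscale x s) t = trscale x (s * t).
Proof. by apply: tring_ext => n /=; rewrite rscaleA. Qed.
Fact trscale1 x : trscale x 1 = x.
Proof. by apply: tring_ext => n /=; rewrite rscale1. Qed.
Fact trscaleAl s x t : trscale (s *: x) t = s *: trscale x t.
Proof. by apply: tring_ext => n /=; rewrite rscaleAl. Qed.
HB.instance Definition _ := Lmodule_isBimodule.Build S S tring
  trscaleDl trscaleDr trscaleA trscale1 trscaleAl.

Lemma tcoefD (x y : tring) n : (x + y) n = x n + y n. Proof. by []. Qed.
Lemma tcoefB (x y : tring) n : (x - y) n = x n - y n. Proof. by []. Qed.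
Lemma tcoef0 n : (0 : tring) n = 0. Proof. by []. Qed.
Lemma tcoefZ s (x : tring) n : (s *: x) n = s *: x n. Proof. by []. Qed.
Lemma tcoefR (x : tring) s n : (x :* s) n = x n :* s. Proof. by []. Qed.
Lemma tcoef_sum (I : Type) (r : seq I) (P : pred I) (F : I -> tring) n :
  (\sum_(i <- r | P i) F i) n = \sum_(i <- r | P i) F i n.
Proof. exact: (big_morph (fun x : tring => x n) (fun x y => tcoefD x y n)). Qed.

Definition tin_fun n (y : tpow n) (m : nat) : tpow m :=
  if @eqP _ n m is ReflectT e then ecast k (tpow k) e y else 0.

Fact tin_bound n (y : tpow n) :
  exists N, forall m, (N <= m)%N -> tin_fun y m = 0.
Proof.
exists n.+1 => m nm; rewrite /tin_fun; case: eqP => // e.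
by rewrite e ltnn in nm.
Qed.
Definition tin n (y : tpow n) : tring := tmk (tin_bound y).

Lemma tin_id n (y : tpow n) : tin y n = y.
Proof. by rewrite /= /tin_fun; case: eqP => // e; rewrite eq_axiomK. Qed.
Lemma tin_neq n (y : tpow n) m : n != m -> tin y m = 0.
Proof. by rewrite /= /tin_fun; case: eqP. Qed.

Lemma tinD n : {morph @tin n : x y / x + y}.
Proof.
move=> x y; apply: tring_ext => m; rewrite tcoefD.
have [e|nm] := eqVneq n m; first by case: m / e; rewrite !tin_id.
by rewrite !tin_neq ?addr0.
Qed.
Lemma tin0 n : tin (0 : tpow n) = 0.
Proof. by apply: (addrI (tin (0 : tpow n))); rewrite -tinD !addr0. Qed.
Lemma tinZ n s (y : tpow n) : tin (s *: y) = s *: tin y.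
Proof.
apply: tring_ext => m; rewrite tcoefZ.
have [e|nm] := eqVneq n m; first by case: m / e; rewrite !tin_id.
by rewrite !tin_neq ?scaler0.
Qed.
Lemma tinR n s (y : tpow n) : tin (y :* s) = tin y :* s.
Proof.
apply: tring_ext => m; rewrite tcoefR.
have [e|nm] := eqVneq n m; first by case: m / e; rewrite !tin_id.
by rewrite !tin_neq ?rscale0l.
Qed.

Lemma tring_sum (x : tring) N : (tsize x <= N)%N -> x = \sum_(n < N) tin (x n).
Proof.
move=> xN; apply: tring_ext => m; rewrite tcoef_sum.
have [mN|Nm] := ltnP m N.
  rewrite (bigD1 (Ordinal mN)) //= [X in X + _]tin_id big1 ?addr0 // => i im.
  by rewrite [LHS]tin_neq //; apply: contraNneq im => im; apply/eqP/val_inj.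
rewrite tsize_coef ?(leq_trans xN) // big1 // => i _.
by rewrite tin_neq // ltn_eqF // (leq_trans (ltn_ord i)).
Qed.

(* Right multiplication by v in V, as the shift x |-> x (x) v. *)
Definition tsnoc_fun (v : V) (x : tring) (n : nat) : tpow n :=
  if n is m.+1 then tpure (x m) v else 0.

Lemma tpure0l (M N : bimodType S S) (y : N) : tpure (0 : M) y = 0.
Proof.
apply: (addrI (tpure 0 y)).
by rewrite -(balDl (balanced_tpure M N)) !addr0.
Qed.

Fact tsnoc_bound v x : exists N, forall n, (N <= n)%N -> tsnoc_fun v x n = 0.
Proof.
by exists (tsize x).+1 => -[//|n] xn /=; rewrite tsize_coef // tpure0l.
Qed.
Definition tsnoc v x : tring := tmk (tsnoc_bound v x).

Lemma tsnocD v : {morph tsnoc v : x y / x + y}.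
Proof.
move=> x y; apply: tring_ext => -[|n] /=; first by rewrite addr0.
exact: (balDl (balanced_tpure _ _)).
Qed.
Lemma tsnocDl x : {morph tsnoc^~ x : v w / v + w}.
Proof.
move=> v w; apply: tring_ext => -[|n] /=; first by rewrite addr0.
exact: (balDr (balanced_tpure _ _)).
Qed.
Lemma tsnocA s v x : tsnoc v (x :* s) = tsnoc (s *: v) x.
Proof.
apply: tring_ext => -[|n] //=; exact: (balA (balanced_tpure _ _)).
Qed.
Lemma tsnoc0 v : tsnoc v 0 = 0.
Proof. by apply: (addrI (tsnoc v 0)); rewrite -tsnocD !addr0. Qed.

Lemma tin_snoc n (y : tpow n) v : @tin n.+1 (tpure y v) = tsnoc v (tin y).
Proof.
apply: tring_ext => -[|m] //=; rewrite /tin_fun.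
  by case: eqP.
case: eqP => e; last by case: eqP => [e'|_]; [rewrite e' in e | rewrite tpure0l].
have e' : n = m by case: e.
by case: m / e' e => e; rewrite !eq_axiomK; case: eqP => // e'; rewrite eq_axiomK.
Qed.

Lemma tring_ind (P : tring -> Prop) : P 0 ->
  (forall x y, P x -> P y -> P (x + y)) ->
  (forall s : S, P (@tin 0 s)) ->
  (forall x v, P x -> P (tsnoc v x)) ->
  forall x, P x.
Proof.
move=> P0 PD Ps Pv x.
suff Pin n (y : tpow n) : P (tin y).
  by rewrite (tring_sum (leqnn (tsize x))); elim/big_ind: _ => // i _; exact: Pin.
elim: n y => [|n IHn] y; first exact: Ps.
elim/(@tens_ind _ _ _ (tpow n) V): y => [|y z|y v]; first by rewrite tin0.
- by rewrite tinD; exact: PD.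
- by rewrite tin_snoc; apply: Pv; exact: IHn.
Qed.

(* x y for y homogeneous: x (y' (x) v) = (x y') (x) v. *)
Fixpoint tmulh (n : nat) : tpow n -> tring -> tring :=
  if n is m.+1 then
    fun y x => tlift (fun y' v => tsnoc v (@tmulh m y' x)) y
  else fun s x => x :* s.

Definition tmul (x y : tring) : tring := \sum_(n < tsize y) tmulh (y n) x.

Lemma tsnocR v s x : tsnoc (v :* s) x = tsnoc v x :* s.
Proof.
apply: tring_ext => -[|n]; rewrite tcoefR /=; first by rewrite rscale0l.
by rewrite [RHS]tens_rscale_pure.
Qed.
Lemma tsnocZ v s x : tsnoc v (s *: x) = s *: tsnoc v x.
Proof.
apply: tring_ext => -[|n]; rewrite tcoefZ /=; first by rewrite scaler0.
by rewrite [RHS]tens_scale_pure.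
Qed.

Lemma tmulh_aux n :
  [/\ forall x, {morph (@tmulh n)^~ x : y z / y + z},
      forall (y : tpow n) s x, tmulh (y :* s) x = tmulh y x :* s &
      forall x, balanced (fun (y : tpow n) (v : V) => tsnoc v (tmulh y x))].
Proof.
elim: n => [|n [_ _ IHb]].
  split=> [x y z|y s x|x]; first exact: rscaleDr.
    by rewrite /= rscaleA.
  split=> [v y z|y v w|y s v] /=; first by rewrite rscaleDr tsnocD.
    exact: tsnocDl.
  by rewrite -rscaleA tsnocA.
have D x : {morph (@tmulh n.+1)^~ x : y z / y + z}.
  by move=> y z; exact: tliftD.
have R (y : tpow n.+1) s x : tmulh (y :* s) x = tmulh y x :* s.
  rewrite /= tlift_map // /tlift /bal_eval rscale_suml.
  by apply: eq_bigr => p _; rewrite tsnocR.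
split=> // x; split=> [v y z|y v w|y s v]; first by rewrite D tsnocD.
  exact: tsnocDl.
by rewrite R tsnocA.
Qed.

Lemma tmulhD n x : {morph (@tmulh n)^~ x : y z / y + z}.
Proof. by have [] := tmulh_aux n. Qed.
Lemma tmulh_bal n x :
  balanced (fun (y : tpow n) (v : V) => tsnoc v (tmulh y x)).
Proof. by have [] := tmulh_aux n. Qed.
Lemma tmulh0 n x : tmulh (0 : tpow n) x = 0.
Proof. by apply: (addrI (tmulh (0 : tpow n) x)); rewrite -tmulhD !addr0. Qed.
Lemma tmulhDr n (y : tpow n) : {morph tmulh y : x x' / x + x'}.
Proof.
elim: n y => [|n IHn] y x x' /=; first exact: rscaleDl.
rewrite /tlift /bal_eval -big_split; apply: eq_bigr => p _ /=.
by rewrite IHn tsnocD.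
Qed.

Lemma tmul_widen x y N : (tsize y <= N)%N ->
  tmul x y = \sum_(n < N) tmulh (y n) x.
Proof.
move=> yN; rewrite /tmul (big_ord_widen _ (fun n => tmulh (y n) x) yN).
rewrite big_mkcond; apply: eq_bigr => i _; case: ltnP => // yi.
by rewrite tsize_coef // tmulh0.
Qed.

Lemma tmulDr x : {morph tmul x : y z / y + z}.
Proof.
move=> y z; pose N := maxn (tsize (y + z)) (maxn (tsize y) (tsize z)).
rewrite !(@tmul_widen _ _ N) ?leq_max ?leqnn ?orbT // -big_split.
by apply: eq_bigr => n _; rewrite tcoefD tmulhD.
Qed.
Lemma tmulDl y : {morph tmul^~ y : x z / x + z}.
Proof.
by move=> x z; rewrite /tmul -big_split; apply: eq_bigr => n _; rewrite tmulhDr.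
Qed.
Lemma tmul0r x : tmul x 0 = 0.
Proof. by apply: (addrI (tmul x 0)); rewrite -tmulDr !addr0. Qed.
Lemma tmul_in0 x (s : S) : tmul x (@tin 0 s) = x :* s.
Proof.
rewrite (@tmul_widen _ _ (maxn (tsize (@tin 0 s)) 1)) ?leq_maxl //.
case: maxn (leq_maxr (tsize (@tin 0 s)) 1) => // N _.
rewrite big_ord_recl tin_id big1 ?addr0 // => i _.
by rewrite tin_neq // tmulh0.
Qed.
Lemma tmul_snoc x v y : tmul x (tsnoc v y) = tsnoc v (tmul x y).
Proof.
pose N := maxn (tsize (tsnoc v y)) (tsize y).
rewrite (@tmul_widen _ _ N.+1) ?(@tmul_widen _ y N) ?leq_maxr //; last first.
  by rewrite leqW // leq_maxl.
rewrite big_ord_recl [tmulh _ _]rscale0r add0r.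
rewrite (big_morph (tsnoc v) (tsnocD v) (tsnoc0 v)).
by apply: eq_bigr => i _; rewrite [LHS]tlift_pure //; exact: tmulh_bal.
Qed.

Lemma tmulZl s x y : tmul (s *: x) y = s *: tmul x y.
Proof.
elim/tring_ind: y => [|y z IHy IHz|t|y v IHy].
- by rewrite !tmul0r scaler0.
- by rewrite !tmulDr IHy IHz scalerDr.
- by rewrite !tmul_in0 rscaleAl.
- by rewrite !tmul_snoc IHy tsnocZ.
Qed.
Lemma tmulR x y s : tmul x (y :* s) = tmul x y :* s.
Proof.
elim/tring_ind: y => [|y z IHy IHz|t|y v IHy].
- by rewrite rscale0l tmul0r rscale0l.
- by rewrite rscaleDl !tmulDr IHy IHz rscaleDl.
- by rewrite tmul_in0 -tinR tmul_in0 rscaleA.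
- by rewrite -tsnocR !tmul_snoc tsnocR.
Qed.

Definition tone : tring := @tin 0 (1 : S).

Fact tmulA : associative tmul.
Proof.
move=> x y z; elim/tring_ind: z => [|z z' IH IH'|s|z v IH].
- by rewrite !tmul0r.
- by rewrite !tmulDr IH IH'.
- by rewrite !tmul_in0 tmulR.
- by rewrite !tmul_snoc IH.
Qed.
Fact tmul1r : right_id tone tmul.
Proof. by move=> x; rewrite tmul_in0 rscale1. Qed.
Fact tmul1l : left_id tone tmul.
Proof.
elim/tring_ind => [|x y IHx IHy|s|x v IH].
- by rewrite tmul0r.
- by rewrite tmulDr IHx IHy.
- by rewrite tmul_in0 -tinR; congr tin; exact: mul1r.
- by rewrite tmul_snoc IH.
Qed.
Fact tmul_addl : left_distributive tmul +%R.
Proof. by move=> x y z; exact: tmulDl. Qed.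
Fact tmul_addr : right_distributive tmul +%R.
Proof. by move=> x y z; exact: tmulDr. Qed.
Fact tone_neq0 : tone != 0.
Proof.
apply/eqP => /(congr1 (fun x : tring => x 0%N)); rewrite tin_id => /eqP.
by apply/negP; exact: oner_neq0.
Qed.
HB.instance Definition _ := GRing.Zmodule_isNzRing.Build tring
  tmulA tmul1l tmul1r tmul_addl tmul_addr tone_neq0.

Definition tsc (s : S) : tring := @tin 0 s.
Definition tgen (v : V) : tring := tsnoc v 1.

Lemma mul_tsc s x : tsc s * x = s *: x.
Proof.
rewrite -[x in RHS]mul1r -[RHS]tmulZl -[in RHS]tinZ; congr (tin _ * x).
by symmetry; exact: mulr1.
Qed.
Lemma tsc_mul s x : x * tsc s = x :* s. Proof. exact: tmul_in0. Qed.
Lemma mul_tgen v x : x * tgen v = tsnoc v x.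
Proof. by rewrite [LHS]tmul_snoc; congr (tsnoc v _); exact: tmul1r. Qed.

Fact tsc_zmod_morphism : zmod_morphism tsc.
Proof.
move=> s t; apply: (addIr (tsc t)); rewrite subrK.
transitivity (@tin 0 (s - t + t : S)); first by symmetry; exact: (@tinD 0).
by rewrite subrK.
Qed.
Fact tsc_monoid_morphism : monoid_morphism tsc.
Proof. by split=> // s t; rewrite tsc_mul -tinR. Qed.
HB.instance Definition _ :=
  GRing.isZmodMorphism.Build S tring tsc tsc_zmod_morphism.
HB.instance Definition _ :=
  GRing.isMonoidMorphism.Build S tring tsc tsc_monoid_morphism.

(* The inverse of T (x) V ~ T^+ on T^+: x |-> sum x_T (x) x_V. *)
Definition tdelta (x : tring) : tens tring V :=
  \sum_(n < tsize x) tlift (fun (y : tpow n) v => tpure (tin y) v) (x n.+1).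

Definition tdeg (n : nat) (x : tring) : Prop := forall m, m != n -> x m = 0.
Definition thom (n : nat) (x : tring) : tring := tin (x n).

End TensorRing.

Arguments tpow {S} V n.
Arguments tin {S V} n y.
Arguments tdeg {S V} n x.
Arguments tsc {S V} s.

Record bihom (B C : pzRingType) (M N : bimodType B C) := BiHom {
  bih :> {linear M -> N};
  bihR : forall x c, bih (x :* c) = bih x :* c }.

Section BiHomOps.
Variables (B C : pzRingType) (L M N : bimodType B C).

Fact bihom_comp_subproof (g : bihom M N) (f : bihom L M) x c :
  (g \o f) (x :* c) = (g \o f) x :* c.
Proof. by rewrite /= !bihR. Qed.
Definition bihom_comp g f : bihom L N := BiHom (bihom_comp_subproof g f).

Definition sbm_incl (U : subbimod M) : bihom U M :=
  @BiHom _ _ U M (val : {linear sbm_sort U -> M}) (fun _ _ => erefl).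
End BiHomOps.

(* The ring morphism T_S(V) -> B induced by g : S -> B and the S-bimodule map
   h : V -> B. *)
Section TensorRingMap.
Variables (S : nzRingType) (V : bimodType S S) (B : pzRingType).
Variables (g : {rmorphism S -> B}) (h : bihom V (bireg g g)).

Fixpoint trmaph (n : nat) : tpow V n -> B :=
  if n is m.+1 then
    fun y => tlift (fun y' v => @trmaph m y' * (h v : B) : B) y
  else fun s => g s.

Definition trmap (x : tring V) : B := \sum_(n < tsize x) trmaph (x n).

Lemma trmaph_aux n :
  [/\ {morph @trmaph n : y z / y + z},
      forall (y : tpow V n) s, trmaph (y :* s) = trmaph y * g s &
      balanced (fun (y : tpow V n) (v : V) => trmaph y * (h v : B) : B)].
Proof.
have bal m : {morph @trmaph m : y z / y + z} ->
    (forall (y : tpow V m) s, trmaph (y :* s) = trmaph y * g s) ->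
    balanced (fun (y : tpow V m) (v : V) => trmaph y * (h v : B) : B).
  move=> D R; split=> [v y z|y v w|y s v]; first by rewrite D mulrDl.
    by rewrite linearD; exact: mulrDr.
  by rewrite R linearZ -mulrA.
elim: n => [|n [_ _ IHb]].
  have D : {morph @trmaph 0 : y z / y + z} by move=> y z; exact: rmorphD.
  have R (y : tpow V 0) s : trmaph (y :* s) = trmaph y * g s by exact: rmorphM.
  by split=> //; exact: bal.
have D : {morph @trmaph n.+1 : y z / y + z} by move=> y z; exact: tliftD.
have R (y : tpow V n.+1) s : trmaph (y :* s) = trmaph y * g s.
  rewrite /= [LHS]tlift_map // /tlift /bal_eval mulr_suml.
  by apply: eq_bigr => p _; rewrite bihR; exact: mulrA.
by split=> //; exact: bal.
Qed.

Lemma trmaphD n : {morph @trmaph n : y z / y + z}.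
Proof. by have [] := trmaph_aux n. Qed.
Lemma trmaph0 n : @trmaph n 0 = 0.
Proof. by apply: (addrI (@trmaph n 0)); rewrite -trmaphD !addr0. Qed.

Lemma trmap_widen (x : tring V) N : (tsize x <= N)%N ->
  trmap x = \sum_(n < N) trmaph (x n).
Proof.
move=> xN; rewrite /trmap (big_ord_widen _ (fun n => trmaph (x n)) xN).
rewrite big_mkcond; apply: eq_bigr => i _; case: ltnP => // xi.
by rewrite tsize_coef // trmaph0.
Qed.

Lemma trmapD : {morph trmap : x y / x + y}.
Proof.
move=> x y; pose N := maxn (tsize (x + y)) (maxn (tsize x) (tsize y)).
rewrite !(@trmap_widen _ N) ?leq_max ?leqnn ?orbT // -big_split.
by apply: eq_bigr => n _; rewrite tcoefD trmaphD.
Qed.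
Lemma trmap0 : trmap 0 = 0.
Proof. by apply: (addrI (trmap 0)); rewrite -trmapD !addr0. Qed.

Lemma trmap_sc s : trmap (tsc s) = g s.
Proof.
rewrite (@trmap_widen _ (maxn (tsize (@tsc S V s)) 1)) ?leq_maxl //.
case: maxn (leq_maxr (tsize (@tsc S V s)) 1) => // N _.
rewrite big_ord_recl tin_id big1 ?addr0 // => i _.
by rewrite tin_neq // trmaph0.
Qed.
Lemma trmap_snoc v x : trmap (tsnoc v x) = trmap x * (h v : B).
Proof.
pose N := maxn (tsize (tsnoc v x)) (tsize x).
rewrite (@trmap_widen _ N.+1) ?(@trmap_widen x N) ?leq_maxr //; last first.
  by rewrite leqW // leq_maxl.
rewrite big_ord_recl [trmaph _]rmorph0 add0r mulr_suml.
apply: eq_bigr => i _; rewrite [LHS]tlift_pure //.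
by have [] := trmaph_aux i.
Qed.

Fact trmap_zmod_morphism : zmod_morphism trmap.
Proof. by move=> x y; apply: (addIr (trmap y)); rewrite -trmapD !subrK. Qed.
Fact trmap_monoid_morphism : monoid_morphism trmap.
Proof.
split=> [|x y]; first by rewrite -[RHS](rmorph1 g) -trmap_sc.
elim/tring_ind: y => [|y z IHy IHz|s|y v IHy].
- by rewrite trmap0 !mulr0 trmap0.
- by rewrite mulrDr !trmapD mulrDr IHy IHz.
- rewrite -/(tsc s) trmap_sc; elim/tring_ind: x => [|x z IHx IHz|t|x v IHx].
  + by rewrite mul0r trmap0 mul0r.
  + by rewrite mulrDl !trmapD mulrDl IHx IHz.
  + by rewrite -/(tsc t) -rmorphM !trmap_sc rmorphM.
  + by rewrite tsc_mul -tsnocR !trmap_snoc bihR; exact: mulrA.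
- by rewrite -mul_tgen mulrA !mul_tgen !trmap_snoc IHy mulrA.
Qed.
HB.instance Definition _ :=
  GRing.isZmodMorphism.Build (tring V) B trmap trmap_zmod_morphism.
HB.instance Definition _ :=
  GRing.isMonoidMorphism.Build (tring V) B trmap trmap_monoid_morphism.

Lemma trmap_gen v : trmap (tgen v) = h v.
Proof. by rewrite trmap_snoc rmorph1; exact: mul1r. Qed.
End TensorRingMap.

Section TGenHom.
Variables (S : nzRingType) (V : bimodType S S).
Local Notation T := (bireg (@tsc S V) (@tsc S V)).

Fact tgen_linear : linear (@tgen S V : V -> T).
Proof.
move=> s v w; rewrite /tgen tsnocDl; congr (_ + _).
rewrite -tsnocA [RHS]mul_tsc -tsnocZ; congr tsnoc.
by rewrite -tsc_mul -mul_tsc mul1r mulr1.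
Qed.
HB.instance Definition _ := GRing.isLinear.Build S V T _ (@tgen S V) tgen_linear.

Fact tgenR v s : (tgen (v :* s) : T) = (tgen v : T) :* s.
Proof. by rewrite [RHS]tsc_mul -tsnocR. Qed.
Definition tgen_hom : bihom V T := BiHom tgenR.
End TGenHom.

Section TDelta.
Variables (S : nzRingType) (V : bimodType S S).
Local Notation T := (tring V).

Lemma tin_tpure_bal n :
  balanced (fun (y : tpow V n) (v : V) => tpure (tin n y) v : tens T V).
Proof.
have bp := balanced_tpure T V.
split=> [v y z|y v w|y s v]; first by rewrite tinD (balDl bp).
  exact: (balDr bp).
by rewrite tinR (balA bp).
Qed.

Lemma tdelta_widen (x : T) N : (tsize x <= N)%N ->
  tdelta x =
  \sum_(n < N) tlift (fun (y : tpow V n) v => tpure (tin n y) v) (x n.+1).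
Proof.
move=> xN; pose F n := tlift (fun (y : tpow V n) v => tpure (tin n y) v) (x n.+1).
rewrite /tdelta (big_ord_widen _ F xN) big_mkcond; apply: eq_bigr => i _.
case: ltnP => // xi; rewrite tsize_coef ?(leq_trans xi) //.
by rewrite (tlift_nil (tin_tpure_bal i)).
Qed.

Lemma tdeltaD : {morph @tdelta S V : x y / x + y}.
Proof.
move=> x y; pose N := maxn (tsize (x + y)) (maxn (tsize x) (tsize y)).
rewrite !(@tdelta_widen _ N) ?leq_max ?leqnn ?orbT // -big_split.
by apply: eq_bigr => n _; rewrite tcoefD; exact: (tliftD (tin_tpure_bal n)).
Qed.

Lemma tdelta_snoc (x : T) v : tdelta (tsnoc v x) = tpure x v.
Proof.
pose N := maxn (tsize (tsnoc v x)) (tsize x).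
rewrite (@tdelta_widen _ N) ?leq_maxl // [in RHS](@tring_sum _ _ x N) ?leq_maxr //.
have bp := balanced_tpure T V.
rewrite (big_morph (fun z : T => tpure z v) (balDl bp v) (tpure0l _ _)).
by apply: eq_bigr => n _; rewrite tlift_pure //; exact: tin_tpure_bal.
Qed.

Lemma tdelta_sc s : tdelta (@tsc S V s) = 0.
Proof.
rewrite /tdelta big1 // => n _.
have -> : @tsc S V s n.+1 = 0 by exact: (@tin_neq S V 0).
exact: (tlift_nil (tin_tpure_bal n)).
Qed.
Lemma tdelta0 : tdelta (0 : T) = 0.
Proof. by rewrite -(tdelta_sc 0) rmorph0. Qed.

Lemma tdeltaZ s (x : T) : tdelta (s *: x) = s *: tdelta x.
Proof.
elim/tring_ind: x => [|x y IHx IHy|t|x v _].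
- by rewrite scaler0 tdelta0 scaler0.
- by rewrite scalerDr !tdeltaD IHx IHy scalerDr.
- by rewrite -/(tsc t) -mul_tsc -rmorphM !tdelta_sc scaler0.
- by rewrite -tsnocZ !tdelta_snoc tens_scale_pure.
Qed.

(* The formula x (x) r |-> sum x f(r_T) (x) r_V, which defines both d_2' and
   partial_2. *)
Variables (E : pzRingType) (g : {rmorphism S -> E}) (f : {rmorphism T -> E}).
Hypothesis fg : forall s, f (tsc s) = g s.
Local Notation regE := (bireg (idfun : {rmorphism E -> E}) g).

Definition dformula (x : regE) (r : T) : tens regE V :=
  tlift (fun (t : T) (v : V) => tpure ((x : E) * f t : regE) v) (tdelta r).

Lemma dformula_inner (x : regE) :
  balanced (fun (t : T) (v : V) => tpure ((x : E) * f t : regE) v).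
Proof.
have bp := balanced_tpure regE V.
split=> [v t u|t v w|t s v].
- by rewrite rmorphD mulrDr (balDl bp).
- exact: (balDr bp).
- by rewrite -tsc_mul rmorphM fg mulrA -(balA bp).
Qed.

Lemma dformula_bal : balanced dformula.
Proof.
have bp := balanced_tpure regE V.
have D x : {morph dformula x : r r' / r + r'}.
  by move=> r r'; rewrite /dformula tdeltaD (tliftD (dformula_inner x)).
have sn x y v : dformula x (tsnoc v y) = tpure ((x : E) * f y : regE) v.
  by rewrite /dformula tdelta_snoc tlift_pure //; exact: dformula_inner.
split=> // [r x y|x s r].
  rewrite /dformula /tlift /bal_eval -big_split; apply: eq_bigr => p _ /=.
  by rewrite -(balDl bp) -mulrDl.
rewrite /dformula tdeltaZ [RHS]tlift_map; last exact: dformula_inner.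
apply: eq_bigr => p _; congr tpure.
by rewrite -mul_tsc rmorphM fg mulrA.
Qed.
End TDelta.

Definition mulset (E : pzRingType) (X Y : set E) : set E :=
  [set a | exists2 s : seq (E * E),
     forall p, p \in s -> X p.1 /\ Y p.2 & a = \sum_(p <- s) p.1 * p.2].
Definition addset (E : zmodType) (X Y : set E) : set E :=
  [set a | exists x y, [/\ X x, Y y & a = x + y]].

Section RingQuotient.
Variables (B : pzRingType) (X : set B).

Definition ideal_gen : set B :=
  [set b | exists2 s : seq (B * B * B),
     forall p, p \in s -> X p.1.2 & b = \sum_(p <- s) p.1.1 * p.1.2 * p.2].

Lemma ideal0 : ideal_gen 0.
Proof. by exists [::] => //; rewrite big_nil. Qed.
Lemma idealD x y : ideal_gen x -> ideal_gen y -> ideal_gen (x + y).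
Proof.
move=> [s sX ->] [t tX ->]; exists (s ++ t); last by rewrite big_cat.
by move=> p; rewrite mem_cat => /orP[/sX|/tX].
Qed.
Lemma idealMl a x : ideal_gen x -> ideal_gen (a * x).
Proof.
move=> [s sX ->]; exists [seq (a * p.1.1, p.1.2, p.2) | p <- s].
  by move=> p /mapP[q /sX qX ->].
by rewrite big_map mulr_sumr; apply: eq_bigr => p _; rewrite /= !mulrA.
Qed.
Lemma idealMr a x : ideal_gen x -> ideal_gen (x * a).
Proof.
move=> [s sX ->]; exists [seq (p.1.1, p.1.2, p.2 * a) | p <- s].
  by move=> p /mapP[q /sX qX ->].
by rewrite big_map mulr_suml; apply: eq_bigr => p _; rewrite /= !mulrA.
Qed.
Lemma idealN x : ideal_gen x -> ideal_gen (- x).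
Proof. by rewrite -mulN1r; exact: idealMl. Qed.

Definition rq_eqv (x y : B) : bool := `[< ideal_gen (x - y) >].
Fact rq_eqv_refl : reflexive rq_eqv.
Proof. by move=> x; apply/asboolP; rewrite subrr; exact: ideal0. Qed.
Fact rq_eqv_sym : symmetric rq_eqv.
Proof. by move=> x y; apply/asboolP/asboolP => /idealN; rewrite opprB. Qed.
Fact rq_eqv_trans : transitive rq_eqv.
Proof.
move=> y x z /asboolP xy /asboolP yz; apply/asboolP.
by rewrite -(subrKA y); exact: idealD.
Qed.
Canonical rq_equiv := EquivRel rq_eqv rq_eqv_refl rq_eqv_sym rq_eqv_trans.

Definition ringquot : Type := {eq_quot rq_equiv}.
HB.instance Definition _ := Choice.on ringquot.
HB.instance Definition _ := EqQuotient.on ringquot.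

Definition rqpi (x : B) : ringquot := \pi_ringquot x.

Lemma rqpiP x y : rqpi x = rqpi y <-> ideal_gen (x - y).
Proof. by split=> [/eqmodP/asboolP|xy]; last exact/eqmodP/asboolP. Qed.
Lemma rqpiK (x : ringquot) : rqpi (repr x) = x. Proof. exact: reprK. Qed.
Lemma repr_rqpi x : ideal_gen (repr (rqpi x) - x).
Proof. by apply/rqpiP; rewrite rqpiK. Qed.

Definition rqadd (x y : ringquot) : ringquot := rqpi (repr x + repr y).
Definition rqopp (x : ringquot) : ringquot := rqpi (- repr x).
Definition rqmul (x y : ringquot) : ringquot := rqpi (repr x * repr y).

Lemma rqaddE x y : rqadd (rqpi x) (rqpi y) = rqpi (x + y).
Proof.
by apply/rqpiP; rewrite opprD addrACA; apply: idealD; exact: repr_rqpi.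
Qed.
Lemma rqoppE x : rqopp (rqpi x) = rqpi (- x).
Proof. by apply/rqpiP; rewrite -opprD; apply: idealN; exact: repr_rqpi. Qed.
Lemma rqmulE x y : rqmul (rqpi x) (rqpi y) = rqpi (x * y).
Proof.
apply/rqpiP; rewrite -(subrKA (x * repr (rqpi y))) -mulrBl -mulrBr.
by apply: idealD; [apply: idealMr | apply: idealMl]; exact: repr_rqpi.
Qed.

Lemma rq_ind (P : ringquot -> Prop) : (forall x, P (rqpi x)) -> forall x, P x.
Proof. by move=> H x; rewrite -[x]rqpiK. Qed.

Fact rqaddA : associative rqadd.
Proof.
elim/rq_ind=> x; elim/rq_ind=> y; elim/rq_ind=> z.
by rewrite !rqaddE addrA.
Qed.
Fact rqaddC : commutative rqadd.
Proof. by elim/rq_ind=> x; elim/rq_ind=> y; rewrite !rqaddE addrC. Qed.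
Fact rqadd0 : left_id (rqpi 0) rqadd.
Proof. by elim/rq_ind=> x; rewrite !rqaddE add0r. Qed.
Fact rqaddN : left_inverse (rqpi 0) rqopp rqadd.
Proof. by elim/rq_ind=> x; rewrite rqoppE rqaddE addNr. Qed.
HB.instance Definition _ :=
  GRing.isZmodule.Build ringquot rqaddA rqaddC rqadd0 rqaddN.

Fact rqmulA : associative rqmul.
Proof.
elim/rq_ind=> x; elim/rq_ind=> y; elim/rq_ind=> z.
by rewrite !rqmulE mulrA.
Qed.
Fact rqmul1l : left_id (rqpi 1) rqmul.
Proof. by elim/rq_ind=> x; rewrite rqmulE mul1r. Qed.
Fact rqmul1r : right_id (rqpi 1) rqmul.
Proof. by elim/rq_ind=> x; rewrite rqmulE mulr1. Qed.
Fact rqmulDl : left_distributive rqmul +%R.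
Proof.
elim/rq_ind=> x; elim/rq_ind=> y; elim/rq_ind=> z.
by rewrite [_ + _]rqaddE !rqmulE [RHS]rqaddE mulrDl.
Qed.
Fact rqmulDr : right_distributive rqmul +%R.
Proof.
elim/rq_ind=> x; elim/rq_ind=> y; elim/rq_ind=> z.
by rewrite [rqpi y + _]rqaddE !rqmulE [RHS]rqaddE mulrDr.
Qed.
HB.instance Definition _ := GRing.Zmodule_isPzRing.Build ringquot
  rqmulA rqmul1l rqmul1r rqmulDl rqmulDr.

Fact rqpi_zmod_morphism : zmod_morphism rqpi.
Proof. by move=> x y; rewrite [- rqpi y]rqoppE [RHS]rqaddE. Qed.
Fact rqpi_monoid_morphism : monoid_morphism rqpi.
Proof. by split=> // x y; rewrite [RHS]rqmulE. Qed.
HB.instance Definition _ :=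
  GRing.isZmodMorphism.Build B ringquot rqpi rqpi_zmod_morphism.
HB.instance Definition _ :=
  GRing.isMonoidMorphism.Build B ringquot rqpi rqpi_monoid_morphism.
End RingQuotient.

Record grsring (S : nzRingType) := GrSRing {
  gr_sort :> pzRingType;
  gr_unit : {rmorphism S -> gr_sort};
  gr_deg : nat -> set gr_sort;
  gr_deg0 : forall n, gr_deg n 0;
  gr_degB : forall n x y, gr_deg n x -> gr_deg n y -> gr_deg n (x - y);
  gr_degS : forall s, gr_deg 0%N (gr_unit s);
  gr_degM : forall n m x y, gr_deg n x -> gr_deg m y -> gr_deg (n + m)%N (x * y);
  gr_span : forall x, exists N (f : nat -> gr_sort),
    (forall n, gr_deg n (f n)) /\ x = \sum_(n < N) f n;
  gr_direct : forall N (f : nat -> gr_sort), (forall n, gr_deg n (f n)) ->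
    \sum_(n < N) f n = 0 -> forall n, (n < N)%N -> f n = 0 }.

Section GradedSRing.
Variables (S : nzRingType) (A : grsring S).

Definition connected : Prop :=
  injective (gr_unit A) /\ forall x, gr_deg 0%N x -> exists s, gr_unit A s = x.

Definition strongly_graded : Prop :=
  forall n m, mulset (@gr_deg S A n) (gr_deg m) = gr_deg (n + m)%N.

Local Notation biA := (bireg (gr_unit A) (gr_unit A)).

Fact gcomp_scale n (s : S) (x : biA) : gr_deg n (x : A) -> gr_deg n (s *: x : A).
Proof. by move=> xn; apply: (gr_degM (gr_degS A s) xn). Qed.
Fact gcomp_rscale n (s : S) (x : biA) : gr_deg n (x : A) -> gr_deg n (x :* s : A).
Proof. by move=> xn; rewrite -[n]addn0; apply: (gr_degM xn (gr_degS A s)). Qed.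

Definition gcomp (n : nat) : subbimod biA :=
  @SubBimod _ _ biA (@gr_deg S A n) (@gr_deg0 S A n) (@gr_degB S A n)
    (@gcomp_scale n) (@gcomp_rscale n).

Definition tpi : tring (gcomp 1) -> A := trmap (sbm_incl (gcomp 1)).
End GradedSRing.

Record gsubbimod (S : nzRingType) (V : bimodType S S) := GSubBimod {
  gsb :> subbimod (tring V);
  gsb_hom : forall n x, gsb x -> gsb (thom n x) }.

Definition bimodule_of_relations (S : nzRingType) (A : grsring S)
    (R : gsubbimod (gcomp A 1)) : Prop :=
  let I : set (tring (gcomp A 1)) := [set x | tpi x = 0] in
  let V : set (tring (gcomp A 1)) := [set x | tdeg 1 x] in
  let J := addset (mulset V I) (mulset I V) in
  [/\ [set x | R x] `<=` I, I = addset [set x | R x] J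
    & [set x | R x] `&` J `<=` [set 0]].

Record filtered_map (S : nzRingType) (V : bimodType S S) (R : gsubbimod V) :=
  FilteredMap {
    filt_map :> bihom R (tring V);
    filt_mapP : forall n (r : R), tdeg n (val r) ->
      forall m, (n < m)%N -> filt_map r m = 0 }.

(* V stands for A^1, so that T is T_A, cext is D, D1 is D^1 and TD is T_D; cpi
   is pi_D, czeta is zeta, cpizeta is their composite, clambda is lambda. *)
Section CentralExtension.
Variables (S : nzRingType) (V : bimodType S S) (R : gsubbimod V).
Variable alpha : filtered_map R.

Local Notation T := (tring V).

Lemma tdeg0 n : tdeg n (0 : T).
Proof. by []. Qed.
Lemma tdegB n (x y : T) : tdeg n x -> tdeg n y -> tdeg n (x - y).
Proof. by move=> xn yn m mn; rewrite tcoefB xn // yn // subr0. Qed.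
Lemma tdeg_gen v : tdeg 1 (@tgen S V v).
Proof.
case=> [|[|m]] // _; have one0 : (1 : T) m.+1 = 0 by exact: (@tin_neq S V 0).
have -> : tgen v m.+2 = tpure ((1 : T) m.+1) v by [].
by rewrite one0 tpure0l.
Qed.

Fact rhom_subproof n (r : R) : R (thom n (val r)).
Proof. exact/gsb_hom/sbm_mem. Qed.
Definition rhom n (r : R) : R := sbm_elt (rhom_subproof n r).

(* [alpha_ 0] is the inclusion, whatever the degree-0 component of alpha. *)
Definition alpha_ (i : nat) (r : R) : T :=
  if i == 0%N then val r
  else \sum_(n < tsize (val r) | (i <= n)%N) thom (n - i) (alpha (rhom n r)).

(* The sum over i stops at the top degree of r, beyond which alpha_i r = 0. *)
Definition alphaz (r : R) : {poly T} := \poly_(i < tsize (val r)) alpha_ i r.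

Definition Pz : set {poly T} := range alphaz.

Definition cext : Type := ringquot Pz.
HB.instance Definition _ := GRing.PzRing.on cext.

Definition cproj : {rmorphism {poly T} -> cext} := rqpi Pz.
(* The structure map S -> D. *)
Definition cext_unit : {rmorphism S -> cext} := cproj \o (polyC \o tsc).

Definition pdeg (n : nat) (p : {poly T}) : Prop :=
  forall i, if (i <= n)%N then tdeg (n - i) p`_i else p`_i = 0.

Definition cdeg (n : nat) : set cext := [set x | exists2 p, pdeg n p & cproj p = x].

Local Notation biD := (bireg cext_unit cext_unit).

Fact cdeg0 n : cdeg n 0.
Proof.
by exists 0; [move=> i; rewrite coef0; case: ifP | exact: rmorph0].
Qed.
Fact cdegB n x y : cdeg n x -> cdeg n y -> cdeg n (x - y).
Proof.
move=> [p pn <-] [q qn <-]; exists (p - q); last exact: rmorphB.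
move=> i; rewrite coefB; have := pn i; have := qn i.
by case: ifP => _ => [qi pi|-> ->]; [exact: tdegB | rewrite subr0].
Qed.
Fact cdeg_scale n (s : S) (x : biD) : cdeg n (x : cext) -> cdeg n (s *: x : cext).
Proof.
move=> [p pn <-]; exists ((tsc s)%:P * p); last exact: rmorphM.
move=> i; rewrite coefCM; have := pn i; case: ifP => _; last by move->; rewrite mulr0.
by move=> pi m mi; rewrite mul_tsc tcoefZ pi // scaler0.
Qed.
Fact cdeg_rscale n (s : S) (x : biD) : cdeg n (x : cext) -> cdeg n (x :* s : cext).
Proof.
move=> [p pn <-]; exists (p * (tsc s)%:P); last exact: rmorphM.
move=> i; rewrite coefMC; have := pn i; case: ifP => _; last by move->; rewrite mul0r.
by move=> pi m mi; rewrite tsc_mul tcoefR pi // rscale0l.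
Qed.

Definition ccomp (n : nat) : subbimod biD :=
  @SubBimod _ _ biD (cdeg n) (@cdeg0 n) (@cdegB n) (@cdeg_scale n)
    (@cdeg_rscale n).
Local Notation D1 := (ccomp 1).

Fact cz_subproof : D1 (cproj 'X).
Proof.
exists 'X => // -[|[|i]]; rewrite coefX //=.
by move=> m m0; apply: (@tin_neq S V 0); rewrite eq_sym.
Qed.
Definition cz : D1 := sbm_elt cz_subproof.

Fact cgen_subproof (v : V) : D1 (cproj (tgen v)%:P).
Proof.
exists (tgen v)%:P => // -[|i]; rewrite coefC /=.
  exact: tdeg_gen.
by case: ifP.
Qed.
Definition cgen_fun (v : V) : D1 := sbm_elt (cgen_subproof v).

Fact cgen_linear : linear cgen_fun.
Proof.
move=> s v w; apply: val_inj => /=.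
rewrite [LHS](_ : _ = cproj (tsc s * tgen v + tgen w)%:P); last first.
  by congr (cproj _%:P); rewrite (linearP (tgen_hom V)).
by rewrite polyCD polyCM rmorphD rmorphM.
Qed.
HB.instance Definition _ := GRing.isLinear.Build S V D1 _ cgen_fun cgen_linear.
Fact cgenR v s : cgen_fun (v :* s) = cgen_fun v :* s.
Proof.
apply: val_inj => /=; rewrite [LHS](_ : _ = cproj (tgen v * tsc s)%:P).
  by rewrite polyCM rmorphM.
by congr (cproj _%:P); exact: tgenR.
Qed.
Definition cgen : bihom V D1 := BiHom cgenR.

Local Notation TD := (tring D1).
Local Notation biTD := (bireg (@tsc S D1) (@tsc S D1)).

Definition cpi : {rmorphism TD -> cext} := trmap (sbm_incl D1).

Definition czeta : {rmorphism T -> TD} := trmap (bihom_comp (tgen_hom D1) cgen).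

Definition cpizeta (t : T) : cext := cpi (czeta t).

(* The map sum_n t_n z^n |-> sum_n czeta t_n (x) z^(x)n. *)
Definition clambda (p : {poly T}) : TD := (map_poly czeta p).[tgen cz].

Definition zcomm (a : V) : TD :=
  tgen cz * tgen (cgen a) - tgen (cgen a) * tgen cz.

Definition RD_set : set TD := addset (clambda @` Pz) (range zcomm).

Lemma rhom0 n (r : R) : (tsize (val r) <= n)%N -> rhom n r = 0.
Proof. by move=> rn; apply: val_inj; rewrite /= /thom tsize_coef // tin0. Qed.
Lemma rhom_linear n : linear (rhom n).
Proof.
move=> s x y; apply: val_inj; rewrite /= /thom -tinZ -tinD.
by congr tin; rewrite tcoefD tcoefZ.
Qed.
Lemma rhomR n r s : rhom n (r :* s) = rhom n r :* s.
Proof. by apply: val_inj; rewrite /= /thom -tinR. Qed.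
Lemma thomD n (x y : T) : thom n (x + y) = thom n x + thom n y.
Proof. by rewrite /thom -tinD. Qed.
Lemma thomZ n s (x : T) : thom n (s *: x) = s *: thom n x.
Proof. by rewrite /thom -tinZ. Qed.
Lemma thomR n s (x : T) : thom n (x :* s) = thom n x :* s.
Proof. by rewrite /thom -tinR. Qed.
Lemma thom0 n : thom n (0 : T) = 0.
Proof. exact: tin0. Qed.

Lemma alpha_widen i r N : (tsize (val r) <= N)%N ->
  alpha_ i r = if i == 0%N then val r else
    \sum_(n < N) if (i <= n)%N then thom (n - i) (alpha (rhom n r)) else 0.
Proof.
move=> rN; rewrite /alpha_; case: ifP => // _.
pose F n := if (i <= n)%N then thom (n - i) (alpha (rhom n r)) else 0.
rewrite big_mkcond (big_ord_widen _ F rN) big_mkcond.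
apply: eq_bigr => n _; case: ltnP => // rn.
by rewrite /F rhom0 // linear0 thom0; case: ifP.
Qed.

Lemma alpha_linear i : linear (alpha_ i).
Proof.
move=> s x y; pose N := maxn (tsize (val (s *: x + y)))
                              (maxn (tsize (val x)) (tsize (val y))).
rewrite !(@alpha_widen i _ N) ?leq_max ?leqnn ?orbT //.
case: ifP => // _; rewrite scaler_sumr -big_split; apply: eq_bigr => n _ /=.
case: ifP => _; last by rewrite scaler0 addr0.
by rewrite rhom_linear linearP thomD thomZ.
Qed.
Lemma alphaR i r s : alpha_ i (r :* s) = alpha_ i r :* s.
Proof.
pose N := maxn (tsize (val (r :* s))) (tsize (val r)).
rewrite !(@alpha_widen i _ N) ?leq_max ?leqnn ?orbT //.
case: ifP => // _; rewrite rscale_suml; apply: eq_bigr => n _ /=.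
case: ifP => _; last by rewrite rscale0l.
by rewrite rhomR bihR thomR.
Qed.
Lemma alpha0_large i r : (tsize (val r) <= i)%N -> alpha_ i r = 0.
Proof.
rewrite /alpha_; case: eqP => [->|_ ri].
  rewrite leqn0 => /eqP r0; apply: tring_ext => n.
  by rewrite tsize_coef ?r0.
rewrite big_pred0 // => n; apply/negbTE; rewrite -ltnNge.
exact: leq_trans (ltn_ord n) ri.
Qed.
Lemma coef_alphaz r i : (alphaz r)`_i = alpha_ i r.
Proof. by rewrite coef_poly; case: ltnP => // ri; rewrite alpha0_large. Qed.

Lemma alphazP s x y : alphaz (s *: x + y) = (tsc s)%:P * alphaz x + alphaz y.
Proof.
apply/polyP => i.
by rewrite coefD coefCM !coef_alphaz alpha_linear mul_tsc.
Qed.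
Lemma alphazR r s : alphaz (r :* s) = alphaz r * (tsc s)%:P.
Proof. by apply/polyP => i; rewrite coefMC !coef_alphaz alphaR tsc_mul. Qed.

Lemma cz_central s : s *: cz = cz :* s.
Proof.
apply: val_inj; transitivity (cproj ((tsc s)%:P * 'X)).
  by symmetry; exact: rmorphM.
by rewrite [(tsc s)%:P * 'X]commr_polyX; exact: rmorphM.
Qed.
Lemma tsc_cz s : tsc s * tgen cz = tgen cz * tsc s.
Proof.
have tZ : tgen (s *: cz) = tsc s * tgen cz by exact: (linearZZ (tgen_hom D1)).
by rewrite -tZ cz_central; exact: tgenR.
Qed.
Lemma czeta_sc s : czeta (tsc s) = tsc s.
Proof. exact: trmap_sc. Qed.

Lemma clambda_linear s p q :
  clambda ((tsc s)%:P * p + q) = s *: clambda p + clambda q.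
Proof.
rewrite /clambda rmorphD rmorphM /= map_polyC /= czeta_sc hornerD.
by rewrite hornerCM mul_tsc.
Qed.
Lemma clambdaR p s : clambda (p * (tsc s)%:P) = clambda p :* s.
Proof.
rewrite /clambda rmorphM /= map_polyC /= czeta_sc hornerM_comm.
  by rewrite hornerC tsc_mul.
by rewrite /comm_poly hornerC tsc_cz.
Qed.

Lemma tgen_cgenP s a b :
  tgen (cgen (s *: a + b)) = tsc s * tgen (cgen a) + tgen (cgen b) :> TD.
Proof. by rewrite linearP (linearP (tgen_hom D1)). Qed.
Lemma tgen_cgenR s a : tgen (cgen (a :* s)) = tgen (cgen a) * tsc s :> TD.
Proof. by rewrite bihR tgenR. Qed.

Lemma zcomm_linear s a b : zcomm (s *: a + b) = s *: zcomm a + zcomm b.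
Proof.
rewrite /zcomm tgen_cgenP -mul_tsc mulrDr mulrDl mulrBr !mulrA tsc_cz.
by rewrite opprD addrACA.
Qed.
Lemma zcommR a s : zcomm (a :* s) = zcomm a :* s.
Proof.
by rewrite /zcomm tgen_cgenR -tsc_mul mulrBl -!mulrA tsc_cz.
Qed.

Fact RD0 : RD_set 0.
Proof.
have a0 : alphaz 0 = 0.
  have := alphazP (-1) 0 0.
  by rewrite scaler0 addr0 rmorphN rmorph1 polyCN mulN1r addNr.
have z0 : zcomm 0 = 0.
  by have := zcomm_linear (-1) 0 0; rewrite scaler0 addr0 scaleN1r addNr.
exists 0, 0; split; last by rewrite addr0.
  exists (alphaz 0); first by exists 0.
  by rewrite a0 /clambda rmorph0 horner0.
by exists 0.
Qed.
Lemma RDP s x y : RD_set x -> RD_set y -> RD_set (s *: x + y).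
Proof.
move=> [_ [_ [[_ [r _ <-] <-] [a _ <-] ->]]].
move=> [_ [_ [[_ [r' _ <-] <-] [a' _ <-] ->]]].
exists (clambda (alphaz (s *: r + r'))), (zcomm (s *: a + a')).
split; [by exists (alphaz (s *: r + r')) => //; exists (s *: r + r')| by exists (s *: a + a')|].
by rewrite alphazP clambda_linear zcomm_linear scalerDr addrACA.
Qed.
Fact RDB x y : RD_set x -> RD_set y -> RD_set (x - y).
Proof. by move=> xR yR; rewrite addrC -scaleN1r; exact: RDP. Qed.
Fact RDZ s x : RD_set x -> RD_set (s *: x).
Proof. by move=> xR; rewrite -[_ *: _]addr0; apply: RDP => //; exact: RD0. Qed.
Fact RDR s x : RD_set x -> RD_set (x :* s).
Proof.
move=> [_ [_ [[_ [r _ <-] <-] [a _ <-] ->]]].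
exists (clambda (alphaz (r :* s))), (zcomm (a :* s)).
split; [by exists (alphaz (r :* s)) => //; exists (r :* s)| by exists (a :* s)|].
by rewrite alphazR clambdaR zcommR rscaleDl.
Qed.
Definition RD : subbimod TD := SubBimod RD0 RDB RDZ RDR.

Definition Dreg : bimodType cext S :=
  bireg (idfun : {rmorphism cext -> cext}) cext_unit.

Local Notation D_A1 := (tens Dreg V).
Local Notation D_R := (tens Dreg R).
Local Notation D_D1 := (tens Dreg D1).
Local Notation D_RD := (tens Dreg RD).

(* The projection onto D^0 = S: the degree-0 part of a representative. *)
Definition delta0 (x : Dreg) : S := ((repr (x : cext))`_0 : T) 0%N.

Definition d1' : D_D1 -> Dreg :=
  tlift (fun (x : Dreg) (y : D1) => (x : cext) * (val y : cext) : Dreg).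
Definition d2' : D_RD -> D_D1 :=
  tlift (fun (x : Dreg) (r : RD) =>
    tlift (fun (t : TD) (y : D1) =>
      tpure ((x : cext) * cpi t : Dreg) y) (tdelta (val r))).

Definition partial1 : D_A1 -> Dreg :=
  tlift (fun (x : Dreg) (a : V) => (x : cext) * (val (cgen a) : cext) : Dreg).
Definition partial2 : D_R -> D_A1 :=
  tlift (fun (x : Dreg) (r : R) =>
    tlift (fun (t : T) (a : V) =>
      tpure ((x : cext) * cpizeta t : Dreg) a) (tdelta (val r))).
Definition f2 : D_R -> Dreg :=
  tlift (fun (x : Dreg) (r : R) =>
    \sum_(1 <= i < tsize (val r))
      (x : cext) * cpizeta (alpha_ i r) * cproj 'X ^+ i.-1 : Dreg).

Definition delta1 (m : (D_A1 * Dreg)%type) : Dreg :=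
  partial1 m.1 + (cproj 'X *: m.2).
Definition delta2 (m : (D_R * D_A1)%type) : (D_A1 * Dreg)%type :=
  (partial2 m.1 - cproj 'X *: m.2, partial1 m.2 + f2 m.1).

Fact cpizeta_sc s : (cpi \o czeta : {rmorphism T -> cext}) (tsc s) = cext_unit s.
Proof. by rewrite /= czeta_sc; exact: trmap_sc. Qed.

Lemma d1'_pure (x : Dreg) (y : D1) :
  d1' (tpure x y) = (x : cext) * (val y : cext) :> cext.
Proof.
apply: tlift_pure; split=> [v x' x''|x' v w|x' s v].
- exact: mulrDl.
- exact: mulrDr.
- by symmetry; exact: mulrA.
Qed.

Lemma d2'_pure (x : Dreg) (r : RD) :
  d2' (tpure x r) =
  tlift (fun (t : TD) (y : D1) => tpure ((x : cext) * cpi t : Dreg) y)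
        (tdelta (val r)).
Proof.
have bal := @dformula_bal S D1 cext cext_unit cpi (trmap_sc (sbm_incl D1)).
rewrite [LHS]tlift_pure //; split=> [v y z|y v w|y s v].
- exact: (balDl bal).
- exact: (balDr bal).
- exact: (balA bal).
Qed.

Lemma partial1_pure (x : Dreg) (a : V) :
  partial1 (tpure x a) = (x : cext) * cproj (tgen a)%:P :> cext.
Proof.
apply: tlift_pure; split=> [v x' x''|x' v w|x' s v].
- exact: mulrDl.
- by rewrite linearD; exact: mulrDr.
- by rewrite linearZ; symmetry; exact: mulrA.
Qed.

Lemma partial2_pure (x : Dreg) (r : R) :
  partial2 (tpure x r) =
  tlift (fun (t : T) (a : V) => tpure ((x : cext) * cpizeta t : Dreg) a)
        (tdelta (val r)).
Proof.
have bal := dformula_bal cpizeta_sc.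
rewrite [LHS]tlift_pure //; split=> [v y z|y v w|y s v].
- exact: (balDl bal).
- exact: (balDr bal).
- exact: (balA bal).
Qed.

Lemma f2_widen (x : Dreg) (r : R) N : (tsize (val r) <= N)%N ->
  \sum_(1 <= i < tsize (val r))
      (x : cext) * cpizeta (alpha_ i r) * cproj 'X ^+ i.-1 =
  \sum_(1 <= i < N) (x : cext) * cpizeta (alpha_ i r) * cproj 'X ^+ i.-1.
Proof.
move=> rN; case r0: (tsize (val r)) => [|n]; last first.
  rewrite [RHS](@big_cat_nat _ _ _ n.+1) ?r0 //=; last by rewrite -r0.
  rewrite [X in _ + X]big_nat_cond [X in _ + X]big1 ?addr0 // => i.
  rewrite andbT => /andP[ni _].
  by rewrite alpha0_large ?r0 // /cpizeta !rmorph0 mulr0 mul0r.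
rewrite big_geq // [RHS]big_nat_cond big1 // => i _.
by rewrite alpha0_large ?r0 // /cpizeta !rmorph0 mulr0 mul0r.
Qed.

Lemma f2_pure (x : Dreg) (r : R) :
  f2 (tpure x r) = \sum_(1 <= i < tsize (val r))
      (x : cext) * cpizeta (alpha_ i r) * cproj 'X ^+ i.-1 :> cext.
Proof.
apply: tlift_pure; split=> [v y z|y v w|y s v].
- by rewrite -big_split; apply: eq_bigr => i _; rewrite !mulrDl.
- pose N := maxn (tsize (val (v + w))) (maxn (tsize (val v)) (tsize (val w))).
  rewrite !(@f2_widen _ _ N) ?leq_max ?leqnn ?orbT // -big_split.
  apply: eq_bigr => i _; have := alpha_linear i 1 v w; rewrite !scale1r => ->.
  by rewrite /cpizeta !rmorphD mulrDr mulrDl.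
- pose N := maxn (tsize (val (s *: v))) (tsize (val v)).
  rewrite !(@f2_widen _ _ N) ?leq_max ?leqnn ?orbT //.
  apply: eq_bigr => i _; have := alpha_linear i s v 0.
  rewrite addr0 (_ : alpha_ i 0 = 0) ?addr0 => [->|]; last first.
    by have := alpha_linear i (-1) 0 0; rewrite scaler0 addr0 scaleN1r addNr.
  have := cpizeta_sc s; rewrite /cpizeta /= => cs.
  by rewrite -mul_tsc !rmorphM /= cs mulrA.
Qed.

Lemma delta0_proj p : (forall r : R, (val r : T) 0%N = 0) ->
  delta0 (cproj p) = (p`_0 : T) 0%N.
Proof.
move=> R0.
have coefM0 (x y : T) : (x * y) 0%N = (x 0%N : S) * (y 0%N : S) :> S.
  elim/tring_ind: y => [|y z IHy IHz|s|y v _].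
  - by rewrite mulr0 tcoef0; symmetry; exact: mulr0.
  - by rewrite mulrDr !tcoefD [RHS]mulrDr -IHy -IHz.
  - by rewrite -/(tsc s) tsc_mul tcoefR tin_id.
  - by rewrite -mul_tgen mulrA !mul_tgen; symmetry; exact: mulr0.
rewrite /delta0; apply/eqP; rewrite -subr_eq0; apply/eqP.
rewrite -[LHS]/(((repr (cproj p : cext))`_0 - p`_0 : T) 0%N) -coefB.
have [s sP ->] := repr_rqpi Pz p.
rewrite coef_sum tcoef_sum big1_seq // => q /andP[_ /sP[r _ qr]].
rewrite -qr !coef0M coef_alphaz !coefM0 [alpha_ 0 r]/(val r) R0.
by rewrite [_ * (0 : S)]mulr0 mul0r.
Qed.
End CentralExtension.

Definition tens_deg (B C E : pzRingType) (M : bimodType B C)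
    (N : bimodType C E) (dM : nat -> set M) (dN : nat -> set N) (n : nat) :
    set (tens M N) :=
  [set t | exists2 s : seq (M * N),
     forall p, p \in s -> exists i j, [/\ (i + j)%N = n, dM i p.1 & dN j p.2] &
     t = \sum_(p <- s) tpure p.1 p.2].

(* A module concentrated in degree d; 0 is homogeneous of every degree. *)
Definition conc_deg (M : zmodType) (d n : nat) : set M :=
  [set x | n = d \/ x = 0].

(* The grading of X(-1). *)
Definition shift_deg (M : zmodType) (dM : nat -> set M) (n : nat) : set M :=
  if n is m.+1 then dM m else [set 0].

Definition prod_deg (M N : zmodType) (dM : nat -> set M) (dN : nat -> set N)
    (n : nat) : set (M * N) :=
  [set x | dM n x.1 /\ dN n x.2].

Definition tsub_deg (S : nzRingType) (V : bimodType S S)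
    (U : subbimod (tring V)) (n : nat) : set U :=
  [set x | tdeg n (val x)].

Record augseq (B : pzRingType) (S : Type) := AugSeq {
  as_2 : lmodType B;
  as_1 : lmodType B;
  as_0 : lmodType B;
  as_deg2 : nat -> set as_2;
  as_deg1 : nat -> set as_1;
  as_deg0 : nat -> set as_0;
  as_d2 : as_2 -> as_1;
  as_d1 : as_1 -> as_0;
  as_aug : as_0 -> S }.

Definition graded_iso (B : pzRingType) (M N : lmodType B) (dM : nat -> set M)
    (dN : nat -> set N) (f : {linear M -> N}) : Prop :=
  bijective f /\ forall n x, dM n x <-> dN n (f x).

(* The isomorphism is the identity on S. *)
Definition augseq_iso (B : pzRingType) (S : Type) (C C' : augseq B S) : Prop :=
  exists (phi2 : {linear as_2 C -> as_2 C'}) (phi1 : {linear as_1 C -> as_1 C'})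
         (phi0 : {linear as_0 C -> as_0 C'}),
    [/\ graded_iso (@as_deg2 _ _ C) (@as_deg2 _ _ C') phi2,
        graded_iso (@as_deg1 _ _ C) (@as_deg1 _ _ C') phi1 &
        graded_iso (@as_deg0 _ _ C) (@as_deg0 _ _ C') phi0] /\
    [/\ forall x, as_d2 (phi2 x) = phi1 (as_d2 x),
        forall x, as_d1 (phi1 x) = phi0 (as_d1 x) &
        forall x, as_aug (phi0 x) = as_aug x].

(* H_1 = ker d_1 / im d_2 is zero. *)
Definition H1_zero (B : pzRingType) (S : Type) (C : augseq B S) : Prop :=
  [set x | @as_d1 _ _ C x = 0] = range (@as_d2 _ _ C).

Section Sequences.
Variables (S : nzRingType) (V : bimodType S S) (R : gsubbimod V).
Variable alpha : filtered_map R.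

Local Notation degD := (@cdeg S V R alpha : nat -> set (Dreg alpha)).

Definition M_seq : augseq (cext alpha) S :=
  @AugSeq (cext alpha) S
    (tens (Dreg alpha) R * tens (Dreg alpha) V)%type
    (tens (Dreg alpha) V * Dreg alpha)%type
    (Dreg alpha)
    (prod_deg (tens_deg degD (@tsub_deg S V R))
              (shift_deg (tens_deg degD (@conc_deg V 1))))
    (prod_deg (tens_deg degD (@conc_deg V 1)) (shift_deg degD))
    degD
    (@delta2 S V R alpha) (@delta1 S V R alpha) (@delta0 S V R alpha).

Definition RD_seq : augseq (cext alpha) S :=
  @AugSeq (cext alpha) S
    (tens (Dreg alpha) (RD alpha))
    (tens (Dreg alpha) (ccomp alpha 1))
    (Dreg alpha)
    (tens_deg degD (@tsub_deg S (ccomp alpha 1) (RD alpha)))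
    (tens_deg degD (@conc_deg (ccomp alpha 1) 1))
    degD
    (@d2' S V R alpha) (@d1' S V R alpha) (@delta0 S V R alpha).
End Sequences.

(* Main.v *)
Require Import Defs.
From HB Require Import structures.
From mathcomp Require Import all_boot all_order all_algebra.
From mathcomp Require Import boolp classical_sets.

(* Relations live in degrees at least 2, so D^1 is the direct sum of A^1 and
   S z, and the ring morphism T_D -> T_A that kills z maps lambda (alpha_z r) to
   r; hence R_D is the direct sum of copies of R and A^1.  Tensoring these two
   decompositions with D gives
     (x (x) a, y) |-> x (x) a + y (x) z  and
     (x (x) r, y (x) a) |-> x (x) lambda (alpha_z r) - y (x) [z, a],
   which with the identity of D form the isomorphism of sequences.
   For the homology, modulo the ideal (R_D) the element z commutes with A^1, so
   lambda becomes a ring morphism that vanishes on P_z; therefore the kernel of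
   pi_D is (R_D).  A cycle of D (x) D^1 is the image sum pi_D(w_T) (x) w_D1 of
   some w in this kernel; in w = sum a r b the terms with b of positive degree
   map to 0, and the others map into the image of d_2'. *)

Set Implicit Arguments.
Unset Strict Implicit.
Unset Printing Implicit Defensive.

Import GRing.Theory.
Local Open Scope classical_set_scope.
Local Open Scope ring_scope.

(** * Functoriality and grading of the tensor product in its right factor *)

Section TensorMaps.
Variables (B C : pzRingType) (M : bimodType B C).

Lemma tlift_linear (N : bimodType C C) (L : lmodType B) (b : M -> N -> L) :
  balanced b -> (forall c x y, b (c *: x) y = c *: b x y) ->
  linear (tlift b).
Proof.
move=> bb bZ c t u; rewrite (tliftD bb); congr (_ + _).
rewrite [LHS]tlift_map // /tlift /bal_eval scaler_sumr.
by apply: eq_bigr => p _; rewrite /= bZ.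
Qed.

Variables (N N' : bimodType C C) (h : {linear N -> N'}).

Definition tmapr : tens M N -> tens M N' := tlift (fun x y => tpure x (h y)).

Fact tmapr_balanced : balanced (fun (x : M) (y : N) => tpure x (h y)).
Proof.
have bp := balanced_tpure M N'.
split=> [y x x'|x y y'|x c y]; first exact: (balDl bp).
  by rewrite linearD; exact: (balDr bp).
by rewrite linearZ; exact: (balA bp).
Qed.

Fact tmapr_linear : linear tmapr.
Proof.
by apply: tlift_linear tmapr_balanced _ => c x y; rewrite tens_scale_pure.
Qed.
HB.instance Definition _ := GRing.isLinear.Build B (tens M N) (tens M N') _
  tmapr tmapr_linear.

Lemma tmapr_pure x y : tmapr (tpure x y) = tpure x (h y).
Proof. exact: tlift_pure tmapr_balanced. Qed.
End TensorMaps.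

Lemma tmapr_comp (B C : pzRingType) (M : bimodType B C)
    (N1 N2 N3 : bimodType C C) (g : {linear N2 -> N3}) (f : {linear N1 -> N2})
    (h : {linear N1 -> N3}) :
  (forall x, g (f x) = h x) ->
  forall t : tens M N1, tmapr g (tmapr f t) = tmapr h t.
Proof.
move=> gf; elim/tens_ind => [|t u IHt IHu|x y]; first by rewrite !linear0.
  by rewrite !linearD /= IHt IHu.
by rewrite !tmapr_pure gf.
Qed.

Lemma tmapr_id (B C : pzRingType) (M : bimodType B C) (N : bimodType C C)
    (h : {linear N -> N}) :
  (forall x, h x = x) -> forall t : tens M N, tmapr h t = t.
Proof.
move=> hid; elim/tens_ind => [|t u IHt IHu|x y]; first by rewrite linear0.
  by rewrite linearD /= IHt IHu.
by rewrite tmapr_pure hid.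
Qed.

Lemma tpure_0l (B C E : pzRingType) (M : bimodType B C) (N : bimodType C E)
    (y : N) : tpure (0 : M) y = 0.
Proof.
by apply: (addrI (tpure 0 y)); rewrite -(balDl (balanced_tpure M N)) !addr0.
Qed.

Lemma tpure_0r (B C E : pzRingType) (M : bimodType B C) (N : bimodType C E)
    (x : M) : tpure x (0 : N) = 0.
Proof.
by apply: (addrI (tpure x 0)); rewrite -(balDr (balanced_tpure M N)) !addr0.
Qed.

Lemma tmapr_0 (B C : pzRingType) (M : bimodType B C) (N N' : bimodType C C)
    (h : {linear N -> N'}) :
  (forall x, h x = 0) -> forall t : tens M N, tmapr h t = 0.
Proof.
move=> h0; elim/tens_ind => [|t u IHt IHu|x y]; first by rewrite linear0.
  by rewrite linearD /= IHt IHu addr0.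
by rewrite tmapr_pure h0 tpure_0r.
Qed.

Lemma tens_degD (B C E : pzRingType) (M : bimodType B C) (N : bimodType C E)
    (dM : nat -> set M) (dN : nat -> set N) n t u :
  tens_deg dM dN n t -> tens_deg dM dN n u -> tens_deg dM dN n (t + u).
Proof.
move=> [s sP ->] [s' s'P ->]; exists (s ++ s'); last by rewrite big_cat.
by move=> p; rewrite mem_cat => /orP[/sP|/s'P].
Qed.

Lemma tens_deg_ind (B C E : pzRingType) (M : bimodType B C) (N : bimodType C E)
    (dM : nat -> set M) (dN : nat -> set N) n (P : tens M N -> Prop) :
  P 0 -> (forall t u, P t -> P u -> P (t + u)) ->
  (forall i j x y, (i + j)%N = n -> dM i x -> dN j y -> P (tpure x y)) ->
  forall t, tens_deg dM dN n t -> P t.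
Proof.
move=> P0 PD Pp t [s sP ->]; rewrite big_seq; elim/big_ind: _ => // p /sP.
by move=> [i [j [ij xi yj]]]; exact: Pp ij xi yj.
Qed.

Lemma tens_deg_pure (B C E : pzRingType) (M : bimodType B C) (N : bimodType C E)
    (dM : nat -> set M) (dN : nat -> set N) i j x y :
  dM i x -> dN j y -> tens_deg dM dN (i + j)%N (tpure x y).
Proof.
move=> xi yj; exists [:: (x, y)]; last by rewrite big_seq1.
by move=> p; rewrite inE => /eqP ->; exists i, j.
Qed.

Lemma tens_deg0 (B C E : pzRingType) (M : bimodType B C) (N : bimodType C E)
    (dM : nat -> set M) (dN : nat -> set N) n : tens_deg dM dN n 0.
Proof. by exists [::] => //; rewrite big_nil. Qed.

Lemma tmapr_deg (B C : pzRingType) (M : bimodType B C) (N N' : bimodType C C)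
    (h : {linear N -> N'}) (dM : nat -> set M) (dN : nat -> set N)
    (dN' : nat -> set N') n t :
  (forall j y, dN j y -> dN' j (h y)) ->
  tens_deg dM dN n t -> tens_deg dM dN' n (tmapr h t).
Proof.
move=> hd; elim/tens_deg_ind => {t} [|t u|i j x y <- xi yj].
- by rewrite linear0; exact: tens_deg0.
- by rewrite linearD; exact: tens_degD.
- by rewrite tmapr_pure; apply: tens_deg_pure => //; exact: hd.
Qed.

(** * Low-degree components and homogeneous elements of a tensor ring *)

Section TensorRingLemmas.
Variables (S : nzRingType) (V : bimodType S S).
Local Notation T := (tring V).

Lemma tcoef0M (x y : T) : (x * y) 0%N = (x 0%N : S) * (y 0%N : S) :> S.
Proof.
elim/tring_ind: y => [|y z IHy IHz|s|y v _].
- by rewrite mulr0 tcoef0; symmetry; exact: mulr0.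
- by rewrite mulrDr !tcoefD [RHS]mulrDr -IHy -IHz.
- by rewrite -/(tsc s) tsc_mul tcoefR tin_id.
- by rewrite -mul_tgen mulrA !mul_tgen; symmetry; exact: mulr0.
Qed.

Lemma tcoef1M (x y : T) :
  (x * y) 1%N = (x 0%N : S) *: y 1%N + x 1%N :* (y 0%N : S).
Proof.
elim/tring_ind: y => [|y z IHy IHz|s|y v _].
- by rewrite mulr0 !tcoef0 scaler0 rscale0r addr0.
- by rewrite mulrDr !tcoefD IHy IHz scalerDr rscaleDr addrACA.
- rewrite -/(tsc s) tsc_mul tcoefR tin_id.
  have -> : @tsc S V s 1%N = 0 by exact: (@tin_neq S V 0).
  by rewrite scaler0 add0r.
- rewrite -mul_tgen mulrA !mul_tgen /= rscale0r addr0.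
  by rewrite [RHS]tens_scale_pure tcoef0M.
Qed.

Lemma tdegD n (x y : T) : tdeg n x -> tdeg n y -> tdeg n (x + y).
Proof. by move=> xn yn m mn; rewrite tcoefD xn // yn // addr0. Qed.

Lemma tdeg_tin n (y : tpow V n) : tdeg n (tin n y).
Proof. by move=> m mn; apply: tin_neq; rewrite eq_sym. Qed.

Lemma tdeg_eq_tin n (x : T) : tdeg n x -> x = tin n (x n).
Proof.
move=> xn; apply: tring_ext => m; have [->|mn] := eqVneq m n.
  by rewrite tin_id.
by rewrite xn // (tdeg_tin _ mn).
Qed.

Lemma tdeg_eq0 n m (x : T) : n != m -> tdeg n x -> tdeg m x -> x = 0.
Proof.
move=> nm xn xm; apply: tring_ext => k; have [->|kn] := eqVneq k n.
  by rewrite xm.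
by rewrite xn.
Qed.

Lemma tdeg_snoc n v (x : T) : tdeg n x -> tdeg n.+1 (tsnoc v x).
Proof. by move=> xn [//|m] mn /=; rewrite xn // tpure0l. Qed.

Lemma tdegM n m (x y : T) : tdeg n x -> tdeg m y -> tdeg (n + m) (x * y).
Proof.
move=> xn /tdeg_eq_tin ->; elim: m (y m) => [|m IHm] {}y.
  rewrite addn0 [_ * _]tsc_mul => k kn.
  by rewrite tcoefR xn // rscale0l.
elim/(@tens_ind _ _ _ (tpow V m) V): y => [|y z IHy IHz|y v].
- by rewrite tin0 mulr0.
- by rewrite tinD mulrDr; exact: tdegD.
- by rewrite tin_snoc -mul_tgen mulrA mul_tgen addnS; apply: tdeg_snoc.
Qed.

(** The degree-1 part of the tensor ring is encoded as [S (x) V]; this is its canonical isomorphism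
    with [V]. *)
Definition tpow1_val (y : tpow V 1) : V :=
  @tlift _ _ _ (tpow V 0) V V (fun s v => (s : S) *: v) y.

Fact tpow1_balanced : @balanced _ _ _ (tpow V 0) V V (fun s v => (s : S) *: v).
Proof.
split=> [v s t|s v w|s t v]; first exact: scalerDl.
  exact: scalerDr.
by rewrite scalerA.
Qed.

Lemma tpow1_valK (y : tpow V 1) : tin 1 y = tgen (tpow1_val y).
Proof.
elim/(@tens_ind _ _ _ (tpow V 0) V): y => [|y z IHy IHz|s v].
- by rewrite tin0 /tpow1_val (tlift_nil tpow1_balanced) (linear0 (tgen_hom V)).
- rewrite tinD IHy IHz /tpow1_val (tliftD tpow1_balanced).
  by rewrite (linearD (tgen_hom V)).
- rewrite tin_snoc /tpow1_val (tlift_pure s v tpow1_balanced).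
  by rewrite (linearZZ (tgen_hom V)) -mul_tgen.
Qed.

Lemma tgen_inj : injective (@tgen S V).
Proof.
move=> v w /(congr1 (fun x : T => tpow1_val (x 1%N))).
rewrite /tpow1_val !(tlift_pure _ _ tpow1_balanced).
by rewrite tin_id !scale1r.
Qed.
End TensorRingLemmas.

Lemma tdeg_trmap (S : nzRingType) (V W : bimodType S S)
    (h : bihom V (bireg (@tsc S W) (@tsc S W))) n x :
  (forall v, tdeg 1 (h v : tring W)) -> tdeg n x -> tdeg n (trmap h x).
Proof.
move=> h1 /tdeg_eq_tin ->; elim: n (x n) => [|n IHn] {}x.
  by rewrite [trmap h _](trmap_sc h); exact: (@tdeg_tin S W 0 x).
elim/(@tens_ind _ _ _ (tpow V n) V): x => [|x y IHx IHy|x v].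
- by rewrite tin0 rmorph0.
- by rewrite tinD rmorphD; exact: tdegD.
- by rewrite tin_snoc trmap_snoc -addn1; exact: tdegM.
Qed.

(** Preimages are chosen classically. The coordinates on [D1] and on [RD] are obtained as the
    components of such an inverse. *)
Lemma linear_inverse (B : pzRingType) (M N : lmodType B) (f : {linear M -> N}) :
  injective f -> (forall y, exists x, f x = y) ->
  exists g : {linear N -> M}, cancel f g /\ cancel g f.
Proof.
move=> f_inj f_surj; pose g y := sval (cid (f_surj y)).
have gK : cancel g f by move=> y; exact: svalP (cid (f_surj y)).
have fK : cancel f g by move=> x; apply: f_inj; rewrite gK.
have g_lin : linear g := can2_linear fK gK.
pose gL : {linear N -> M} := HB.pack g (GRing.isLinear.Build B N M _ g g_lin).
by exists gL.
Qed.

Section TensorUnit.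
Variables (B C : pzRingType) (M : bimodType B C).
Local Notation regC := (bireg (idfun : {rmorphism C -> C}) idfun).

(** The canonical isomorphism of [M (x)_C C] with [M]; it turns a [z]-coordinate in [D (x) S] into
    an element of [D]. *)
Definition tunit : tens M regC -> M := tlift (fun x (c : regC) => x :* (c : C)).

Fact tunit_balanced : balanced (fun (x : M) (c : regC) => x :* (c : C)).
Proof.
split=> [c x y|x c d|x c d]; [exact: rscaleDl|exact: rscaleDr|exact: rscaleA].
Qed.
Fact tunit_linear : linear tunit.
Proof. by apply: tlift_linear tunit_balanced _ => b x c; rewrite rscaleAl. Qed.
HB.instance Definition _ := GRing.isLinear.Build B (tens M regC) M _
  tunit tunit_linear.

Lemma tunit_pure x c : tunit (tpure x c) = x :* (c : C).
Proof. exact: tlift_pure tunit_balanced. Qed.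
End TensorUnit.

(** * Degrees of the components of [alpha] *)

Section CentralExtension.
Variables (S : nzRingType) (V : bimodType S S) (R : gsubbimod V).
Variable alpha : filtered_map R.

Local Notation T := (tring V).
Local Notation D := (cext alpha).
Local Notation D1 := (ccomp alpha 1).
Local Notation TD := (tring D1).
Local Notation RD := (RD alpha).
Local Notation Dreg := (Dreg alpha).
Local Notation cproj := (cproj alpha).
Local Notation cpi := (cpi alpha).
Local Notation czeta := (czeta alpha).
Local Notation clambda := (clambda alpha).
Local Notation cgen := (cgen alpha).
Local Notation cz := (cz alpha).
Local Notation zcomm := (zcomm alpha).
Local Notation Pz := (Pz alpha).

(** The component [alpha_ i] lowers degrees by [i], so only the part of [r] in degree [m + i]
    reaches degree [m]. The case i = 0 is excluded because [alpha_ 0] is the inclusion by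
    convention. *)
Lemma alpha_coef i (r : R) m :
  i != 0%N -> alpha_ alpha i r m = alpha (rhom (m + i) r) m.
Proof.
(* The bound makes the index [m + i] occur in the sum even when it exceeds the top degree of [r]. *)
move=> i0; pose N := maxn (Defs.tsize (val r)) (m + i).+1.
rewrite (@alpha_widen _ _ _ _ i _ N) ?leq_maxl // (negbTE i0) tcoef_sum.
have mN : (m + i < N)%N by rewrite leq_maxr.
rewrite (bigD1 (Ordinal mN)) //= leq_addl addnK [X in X + _]tin_id.
rewrite big1 ?addr0 // => n nm; case: ifP => // le_in.
apply: tin_neq; apply: contraNneq nm => nim.
by apply/eqP/val_inj; rewrite /= -nim subnK.
Qed.

Lemma rhom_eq0 n (r : R) : (val r : T) n = 0 -> rhom n r = 0.
Proof. by move=> rn; apply: val_inj; rewrite /= /thom rn tin0. Qed.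

Lemma alphaz_deg j (r : R) : tdeg j (val r) -> pdeg j (alphaz alpha r).
Proof.
move=> rj i; rewrite coef_alphaz; have [->|i0] := eqVneq i 0%N.
  by rewrite leq0n subn0.
have coef0 m : (m + i)%N != j -> alpha_ alpha i r m = 0.
  by move=> mj; rewrite alpha_coef // rhom_eq0 ?linear0 // rj.
case: leqP => ij.
  by move=> m mj; apply: coef0; apply: contraNneq mj => <-; rewrite addnK.
by apply: tring_ext => m; rewrite coef0 //;
  apply: contraTneq ij => <-; rewrite -leqNgt leq_addl.
Qed.

(** * The ideal generated by [Pz] vanishes in total degree at most 1 *)

Definition rels_deg_ge2 : Prop :=
  forall r : R, (val r : T) 0%N = 0 /\ (val r : T) 1%N = 0.

Hypothesis R_ge2 : rels_deg_ge2.

(* Vanishing of the components of total degree at most 1. *)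
Definition deg_ge2 (p : {poly T}) : Prop :=
  [/\ (p`_0 : T) 0%N = 0, (p`_0 : T) 1%N = 0 & (p`_1 : T) 0%N = 0].

Lemma deg_ge2Ml p q : deg_ge2 q -> deg_ge2 (p * q).
Proof.
move=> [q00 q01 q10]; split.
- by rewrite coef0M tcoef0M q00; exact: mulr0.
- by rewrite coef0M tcoef1M q01 q00 scaler0 rscale0r addr0.
- rewrite coefM !big_ord_recl big_ord0 !tcoefD !tcoef0M q00 q10 tcoef0.
  by rewrite addr0 [X in X + _]mulr0 [X in _ + X]mulr0 addr0.
Qed.

Lemma deg_ge2Mr p q : deg_ge2 p -> deg_ge2 (p * q).
Proof.
move=> [p00 p01 p10]; split.
- by rewrite coef0M tcoef0M p00; exact: mul0r.
- by rewrite coef0M tcoef1M p01 p00 scale0r rscale0l addr0.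
- rewrite coefM !big_ord_recl big_ord0 !tcoefD !tcoef0M p00 p10 tcoef0.
  by rewrite addr0 [X in X + _]mul0r [X in _ + X]mul0r addr0.
Qed.

Lemma deg_ge2_alphaz r : deg_ge2 (alphaz alpha r).
Proof.
have [r0 r1] := R_ge2 r; split; rewrite coef_alphaz //.
(* The degree-0 part of [alpha_ 1 r] comes from the degree-1 part of [r], which is zero. *)
by rewrite alpha_coef // rhom_eq0 // linear0.
Qed.

Lemma deg_ge2_ideal p : ideal_gen Pz p -> deg_ge2 p.
Proof.
move=> [s sP ->]; rewrite big_seq; elim/big_ind: _ => [|p1 p2|q /sP[r _ <-]].
- by split; rewrite coef0.
- move=> [p00 p01 p10] [q00 q01 q10].
  by split; rewrite coefD tcoefD ?p00 ?p01 ?p10 ?q00 ?q01 ?q10 addr0.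
- exact/deg_ge2Mr/deg_ge2Ml/deg_ge2_alphaz.
Qed.

(** * The decomposition of [D1] into [A^1] and [S z] *)

Local Notation regS := (bireg (idfun : {rmorphism S -> S}) idfun).

Definition D1_of (u : V * regS) : D1 := cgen u.1 + (u.2 : S) *: cz.

Fact D1_of_linear : linear D1_of.
Proof.
move=> s u v; rewrite /D1_of /= linearP scalerDl scalerDr scalerA.
by rewrite addrACA.
Qed.
HB.instance Definition _ := GRing.isLinear.Build S (V * regS)%type D1 _
  D1_of D1_of_linear.

Lemma val_D1_of u : val (D1_of u) = cproj ((tgen u.1)%:P + (tsc u.2)%:P * 'X).
Proof. by rewrite rmorphD rmorphM. Qed.

Lemma linpoly_coef0 (x y : T) : (x%:P + y%:P * 'X)`_0 = x.
Proof. by rewrite coefD coefC coefMX; exact: addr0. Qed.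
Lemma linpoly_coef1 (x y : T) : (x%:P + y%:P * 'X)`_1 = y.
Proof. by rewrite coefD coefC coefMX coefC; exact: add0r. Qed.

(** If a + s z vanishes in [D], this linear polynomial lies in the ideal of [Pz], which has nothing
    in total degree at most 1. *)
Lemma D1_of_inj : injective D1_of.
Proof.
move=> u v uv; apply/eqP; rewrite -subr_eq0; apply/eqP.
have uv0 : D1_of (u - v) = 0.
  by rewrite linearB; apply/eqP; rewrite subr_eq0; exact/eqP.
have : val (D1_of (u - v)) = cproj 0 by rewrite uv0 rmorph0.
rewrite val_D1_of; case: (u - v) => a s /rqpiP.
rewrite subr0 => /deg_ge2_ideal[_].
rewrite linpoly_coef0 linpoly_coef1 => a0 s0.
congr (_, _); last by rewrite -[RHS]s0 [RHS](@tin_id S V 0).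
apply: tgen_inj; rewrite (linear0 (tgen_hom V)).
have a1 := @tdeg_gen S V a.
by rewrite (tdeg_eq_tin a1) a0 tin0.
Qed.

Lemma D1_of_surj (d : D1) : exists u, D1_of u = d.
Proof.
have [p pdeg1 pd] := sbm_mem d.
(* A polynomial of total degree 1 has a constant coefficient of degree 1, a linear coefficient of
   degree 0 and no others. *)
exists (tpow1_val ((p`_0 : T) 1%N), (p`_1 : T) 0%N); apply: val_inj.
rewrite val_D1_of -pd; congr (cproj _); apply/polyP => i.
rewrite coefD coefC coefMX coefC.
have := pdeg1 i; case: i => [|[|i]] /=; last by move->; rewrite addr0.
  by rewrite subn0 addr0 => /tdeg_eq_tin ->; rewrite tin_id tpow1_valK.
by rewrite subnn add0r => /tdeg_eq_tin ->; rewrite tin_id.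
Qed.
Lemma D1_coordinates : exists (rho : bihom D1 V) (sigma : {linear D1 -> regS}),
  [/\ forall d, cgen (rho d) + (sigma d : S) *: cz = d,
      forall a, rho (cgen a) = a, rho cz = 0,
      forall a, sigma (cgen a) = 0 & sigma cz = (1 : S)].
Proof.
have [g [fK gK]] := linear_inverse D1_of_inj D1_of_surj.
(* The projection to [A^1] is right linear because [z] commutes with [S]: (a + s z) c = a c + (s c)
   z. *)
have rhoR d c : (g (d :* c)).1 = (g d).1 :* c.
  pose u : V * regS := ((g d).1 :* c, ((g d).2 : S) * c).
  rewrite -[d in LHS]gK (_ : D1_of _ :* c = D1_of u) ?fK //.
  rewrite /D1_of rscaleDl bihR rscaleAl -cz_central scalerA //.
have gen a : g (cgen a) = (a, 0).
  by rewrite -[RHS]fK /= /D1_of /= scale0r addr0.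
have gz : g cz = (0, 1 : S).
  by rewrite -[RHS]fK /= /D1_of /= scale1r linear0 add0r.
exists (@BiHom _ _ D1 V (fst \o g : {linear D1 -> V}) rhoR).
exists (snd \o g : {linear D1 -> regS}).
by split=> [d|a||a|] /=; rewrite ?gen ?gz //; exact: gK.
Qed.

(** * The decomposition of [RD] into copies of [R] and [A^1] *)

(** The projection [rho] of [D1] onto [A^1] induces the ring morphism [kappa]. It kills [z], hence
    all commutators with [z], and so recovers [r] from an element of [RD]. *)
Lemma czeta_retraction : exists kappa : {rmorphism TD -> T},
  [/\ forall t, kappa (czeta t) = t, kappa (tgen cz) = 0 &
      forall n x, tdeg n x -> tdeg n (kappa x)].
Proof.
have [rho [_ [_ rhoK rhoz _ _]]] := D1_coordinates.
pose h := bihom_comp (tgen_hom V) rho.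
exists (trmap h); split=> [t||n x];
  last by apply: tdeg_trmap => v; exact: tdeg_gen.
  elim/tring_ind: t => [|x y IHx IHy|s|x v IHx].
  - by rewrite !rmorph0.
  - by rewrite !rmorphD /= IHx IHy.
  - by rewrite -/(tsc s) czeta_sc; exact: trmap_sc.
  - rewrite -mul_tgen !rmorphM /= IHx; congr (_ * _).
    rewrite [czeta _]trmap_gen [LHS]trmap_gen /=.
    by congr tgen; exact: rhoK.
by rewrite [LHS]trmap_gen /= rhoz; exact: (linear0 (tgen_hom V)).
Qed.

Lemma kappa_clambda (kappa : {rmorphism TD -> T}) p :
  (forall t, kappa (czeta t) = t) -> kappa (tgen cz) = 0 ->
  kappa (clambda p) = p`_0.
Proof.
move=> kK kz; rewrite /clambda -horner_map /= kz -map_poly_comp.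
rewrite (_ : map_poly _ p = p) ?horner_coef0 //.
by apply/polyP => i; rewrite coef_map /= kK.
Qed.

(** Splitting off the last factor of z (x) c - c (x) z and applying [sigma] to it kills the first
    term and leaves c. *)
Lemma zcomm_inj : injective zcomm.
Proof.
move=> a b ab; apply/eqP; rewrite -subr_eq0; apply/eqP.
have : zcomm (a - b) = 0.
  by have := zcomm_linear alpha (-1) b a; rewrite !scaleN1r addrC ab addNr.
move: (a - b) => c; rewrite /zcomm !mul_tgen => /(congr1 (@tdelta _ _)).
have [rho [sigma [_ _ _ sg sz]]] := D1_coordinates.
rewrite tdeltaD -scaleN1r tdeltaZ scaleN1r !tdelta_snoc tdelta0 => /subr0_eq.
have [kappa [kK _ _]] := czeta_retraction.
pose b0 (t : TD) (d : D1) : TD := t :* (sigma d : S).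
have bal : balanced b0.
  split=> [d t u|t d e|t s d]; rewrite /b0; first exact: rscaleDl.
    by rewrite linearD rscaleDr.
  by rewrite linearZ rscaleA.
move/(congr1 (tlift b0)); rewrite !tlift_pure // /b0 sg sz rscale0r rscale1.
move/(congr1 kappa); rewrite rmorph0 => kc; apply: tgen_inj.
rewrite (linear0 (tgen_hom V)) kc -[LHS]kK; congr (kappa _).
by rewrite [czeta _]trmap_gen.
Qed.

Fact lamR_subproof (r : R) : RD (clambda (alphaz alpha r)).
Proof.
have z0 : zcomm 0 = 0.
  by have := zcomm_linear alpha (-1) 0 0; rewrite scaler0 addr0 scaleN1r addNr.
exists (clambda (alphaz alpha r)), (zcomm 0); split; last by rewrite z0 addr0.
  by exists (alphaz alpha r) => //; exists r.
by exists 0.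
Qed.
Definition lamR (r : R) : RD := sbm_elt (lamR_subproof r).
Fact lamR_linear : linear lamR.
Proof.
by move=> s x y; apply: val_inj; rewrite /= alphazP clambda_linear.
Qed.
HB.instance Definition _ := GRing.isLinear.Build S R RD _ lamR lamR_linear.

Fact zcomR_subproof (a : V) : RD (zcomm a).
Proof.
have l0 : clambda (alphaz alpha 0) = 0.
  rewrite -[clambda _]/(val (lamR 0)).
  by rewrite (linear0 lamR).
exists (clambda (alphaz alpha 0)), (zcomm a); split; last by rewrite l0 add0r.
  by exists (alphaz alpha 0) => //; exists 0.
by exists a.
Qed.
Definition zcomR (a : V) : RD := sbm_elt (zcomR_subproof a).
Fact zcomR_linear : linear zcomR.
Proof. by move=> s x y; apply: val_inj; exact: zcomm_linear. Qed.
HB.instance Definition _ := GRing.isLinear.Build S V RD _ zcomR zcomR_linear.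

Lemma zcomm0 : zcomm 0 = 0.
Proof. exact: (congr1 val (linear0 zcomR)). Qed.

Definition RD_of (u : R * V) : RD := lamR u.1 + zcomR u.2.
Fact RD_of_linear : linear RD_of.
Proof. by move=> s u v; rewrite /RD_of !linearP scalerDr addrACA. Qed.
HB.instance Definition _ := GRing.isLinear.Build S (R * V)%type RD _
  RD_of RD_of_linear.

Lemma RD_of_surj w : exists u, RD_of u = w.
Proof.
have [_ [_ [[_ [r _ <-] <-] [a _ <-] wE]]] := sbm_mem w.
by exists (r, a); apply: val_inj; rewrite wE.
Qed.

Lemma kappa_zcomm (kappa : {rmorphism TD -> T}) a :
  kappa (tgen cz) = 0 -> kappa (zcomm a) = 0.
Proof.
by move=> kz; rewrite /zcomm rmorphB !rmorphM /= kz mulr0 mul0r subr0.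
Qed.

(** Applying [kappa] to a vanishing sum gives r = 0; what remains is [z, a] = 0, so a = 0 by
    [zcomm_inj]. *)
Lemma RD_of_inj : injective RD_of.
Proof.
move=> u v uv; apply/eqP; rewrite -subr_eq0; apply/eqP.
have : RD_of (u - v) = 0.
  by rewrite linearB; apply/eqP; rewrite subr_eq0; exact/eqP.
case: (u - v) => r a /(congr1 val) /= w0.
have [kappa [kK kz _]] := czeta_retraction.
have r0 : r = 0.
  apply: val_inj; rewrite -[RHS](rmorph0 kappa) -w0 rmorphD /= kappa_zcomm //.
  by rewrite kappa_clambda // coef_alphaz addr0.
congr (_, _); first by [].
have l0 : clambda (alphaz alpha 0) = 0 := congr1 val (linear0 lamR).
by apply: zcomm_inj; move: w0; rewrite r0 l0 add0r zcomm0.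
Qed.

(** * Degrees of commutators, of [czeta] and of [clambda] *)

Lemma zcomm_deg a : tdeg 2 (zcomm a).
Proof. by apply: tdegB; apply: (@tdegM S D1 1 1); exact: tdeg_gen. Qed.

Lemma czeta_deg n t : tdeg n t -> tdeg n (czeta t).
Proof. by apply: tdeg_trmap => v; exact: tdeg_gen. Qed.

Lemma clambda_widen (p : {poly T}) N : (size p <= N)%N ->
  clambda p = \sum_(i < N) czeta p`_i * tgen cz ^+ i.
Proof.
move=> pN; rewrite /clambda (horner_coef_wide _ (leq_trans (size_poly _ _) pN)).
by apply: eq_bigr => i _; rewrite coef_map.
Qed.

Lemma clambdaE p : clambda p = \sum_(i < size p) czeta p`_i * tgen cz ^+ i.
Proof. exact: clambda_widen (leqnn _). Qed.

Lemma clambda_deg n p : pdeg n p -> tdeg n (clambda p).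
Proof.
move=> pn; rewrite clambdaE; elim/big_ind: _ => [|x y|i _]; first exact: tdeg0.
  exact: tdegD.
have zi : tdeg i (tgen cz ^+ i).
  elim: (nat_of_ord i) => [|k IHk]; first exact: (@tdeg_tin S D1 0 (1 : S)).
  by rewrite exprSr -[k.+1]addn1; apply: tdegM => //; exact: tdeg_gen.
have := pn i; case: leqP => [le_in pi|_ ->]; last by rewrite rmorph0 mul0r.
by rewrite -(subnK le_in); apply: tdegM => //; exact: czeta_deg.
Qed.

Local Notation degD := (@cdeg S V R alpha : nat -> set Dreg).

Lemma cdegR n (x : Dreg) s : degD n x -> degD n (x :* s).
Proof. exact: (@cdeg_rscale S V R alpha n s x). Qed.

Lemma cdegD n (x y : D) : cdeg n x -> cdeg n y -> cdeg n (x + y).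
Proof.
move=> xn yn; rewrite -[y]opprK; apply: cdegB => //.
by rewrite -sub0r; apply: cdegB => //; exact: cdeg0.
Qed.

(** * The graded isomorphisms [phi1] and [phi2] *)

Definition phi1 (m : (tens Dreg V * Dreg)%type) : tens Dreg D1 :=
  tmapr cgen m.1 + tpure m.2 cz.

Fact phi1_linear : linear phi1.
Proof.
move=> x m m'; rewrite /phi1 /= linearP (balDl (balanced_tpure _ _)).
by rewrite -tens_scale_pure scalerDr addrACA.
Qed.
HB.instance Definition _ := GRing.isLinear.Build D
  (tens Dreg V * Dreg)%type (tens Dreg D1) _ phi1 phi1_linear.

Lemma phi1D : {morph phi1 : m m' / m + m'}.
Proof. exact: linearD. Qed.

Lemma phi1_iso : graded_iso
  (prod_deg (tens_deg degD (@conc_deg V 1)) (shift_deg degD))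
  (tens_deg degD (@conc_deg D1 1)) phi1.
Proof.
have [rho [sigma [rsK rhoK rhoz sg sz]]] := D1_coordinates.
(* The inverse tensors the coordinates [rho] and [sigma] of [D1] with [D]. *)
pose psi u : (tens Dreg V * Dreg)%type :=
  (tmapr rho u, tunit (tmapr sigma u)).
have psiD u v : psi (u + v) = psi u + psi v by rewrite /psi !linearD.
have psi0 : psi 0 = 0 by rewrite /psi !linear0.
have psiK : cancel psi phi1.
  elim/tens_ind => [|t u IHt IHu|x d]; first by rewrite psi0 linear0.
    by rewrite psiD phi1D IHt IHu.
  rewrite /psi /phi1 /= !tmapr_pure tunit_pure.
  by rewrite (balA (balanced_tpure _ _)) -(balDr (balanced_tpure _ _)) rsK.
have phiK : cancel phi1 psi.
  move=> [t y]; rewrite /phi1 /= psiD /psi !tmapr_pure tunit_pure.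
  rewrite rhoz sz rscale1 tpure_0r; apply: injective_projections => /=.
    by rewrite (tmapr_comp (h := idfun)) // tmapr_id // addr0.
  by rewrite (tmapr_comp (h := \0)) // tmapr_0 // linear0 add0r.
split; first by exists psi.
have degf n m : prod_deg (tens_deg degD (@conc_deg V 1)) (shift_deg degD) n m ->
    tens_deg degD (@conc_deg D1 1) n (phi1 m).
  case: m => t y [/= tn yn]; apply: tens_degD.
    by apply: tmapr_deg tn => j v [->|->]; [left|right; rewrite linear0].
  (* D(-1) is zero in degree 0; in degree n + 1 the element y has degree n, and z supplies the
     missing 1. *)
  case: n yn {tn} => [->|n yn]; first by rewrite tpure_0l; exact: tens_deg0.
  by rewrite -[n.+1]addn1; apply: tens_deg_pure => //; left.
have degg n u : tens_deg degD (@conc_deg D1 1) n u ->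
    prod_deg (tens_deg degD (@conc_deg V 1)) (shift_deg degD) n (psi u).
  move=> un; split.
    by apply: tmapr_deg un => j d [->|->]; [left|right; rewrite linear0].
  elim/tens_deg_ind: un => {u} [|t u|i j x d ij xi dj] /=.
  - rewrite !linear0; case: n => [//|n]; exact: cdeg0.
  - rewrite !linearD /=; case: n => [-> ->|n]; [exact: addr0|exact: cdegD].
  - rewrite tmapr_pure tunit_pure -ij; case: dj => [->|->].
      by rewrite addn1; exact: cdegR.
    rewrite linear0 rscale0r; case: (i + j)%N => [//|k]; exact: cdeg0.
move=> n m; split; first exact: degf.
by rewrite -{2}[m]phiK; exact: degg.
Qed.

(** The minus sign matches [delta2]: on y (x) [z, a] the map [d2'] gives zy (x) a - ya (x) z,
    whereas [delta2] has -zy in its first component and + [partial1] in its second. *)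
Definition phi2 (m : (tens Dreg R * tens Dreg V)%type) : tens Dreg RD :=
  tmapr lamR m.1 - tmapr zcomR m.2.

Fact phi2_linear : linear phi2.
Proof.
move=> x m m'; rewrite /phi2 /= (@tmapr_linear _ _ _ _ _ lamR).
by rewrite (@tmapr_linear _ _ _ _ _ zcomR) scalerBr opprD addrACA.
Qed.
HB.instance Definition _ := GRing.isLinear.Build D
  (tens Dreg R * tens Dreg V)%type (tens Dreg RD) _ phi2 phi2_linear.
Lemma phi2D : {morph phi2 : m m' / m + m'}.
Proof. exact: linearD. Qed.

(** Since [kappa] preserves degrees, r has degree n, and then so does its image under [clambda].
    Hence [z, a] is homogeneous of degree n as well as of degree 2, and it vanishes unless n = 2. *)
Lemma RD_of_deg n r a : tdeg n (val (RD_of (r, a))) ->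
  tdeg n (val r) /\ (n = 2%N \/ a = 0).
Proof.
move=> wn; have [kappa [kK kz kdeg]] := czeta_retraction.
have rn : tdeg n (val r).
  have := kdeg _ _ wn; rewrite /= rmorphD /= kappa_zcomm // kappa_clambda //.
  by rewrite coef_alphaz addr0.
split=> //; have [->|n2] := eqVneq n 2%N; [by left|right].
have zan : tdeg n (zcomm a).
  have := tdegB wn (clambda_deg (alphaz_deg rn)).
  by rewrite /= addrAC subrr add0r.
apply: zcomm_inj; rewrite (tdeg_eq0 n2 zan (zcomm_deg a)).
by rewrite zcomm0.
Qed.

Lemma phi2_iso : graded_iso
  (prod_deg (tens_deg degD (@tsub_deg S V R))
            (shift_deg (tens_deg degD (@conc_deg V 1))))
  (tens_deg degD (@tsub_deg S D1 RD)) phi2.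
Proof.
have [g [fK gK]] := linear_inverse RD_of_inj RD_of_surj.
pose g1 : {linear RD -> R} := fst \o g.
pose g2 : {linear RD -> V} := snd \o g.
have glam r : g (lamR r) = (r, 0).
  by rewrite -[RHS]fK /= /RD_of /= linear0 addr0.
have gzc a : g (zcomR a) = (0, a).
  by rewrite -[RHS]fK /= /RD_of /= linear0 add0r.
pose psi w : (tens Dreg R * tens Dreg V)%type := (tmapr g1 w, - tmapr g2 w).
have psiD u v : psi (u + v) = psi u + psi v by rewrite /psi !linearD.
have psi0 : psi 0 = 0 by rewrite /psi !linear0.
have psiK : cancel psi phi2.
  elim/tens_ind => [|t u IHt IHu|x w]; first by rewrite psi0 linear0.
    by rewrite psiD phi2D IHt IHu.
  rewrite /psi /phi2 /= linearN opprK /= !tmapr_pure.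
  by rewrite -(balDr (balanced_tpure _ _)) -[in RHS](gK w).
have phiK : cancel phi2 psi.
  move=> [t u]; rewrite /phi2 /=; apply: injective_projections => /=.
    rewrite linearB /= (tmapr_comp (h := idfun)) => [|r];
      last by rewrite /= glam.
    rewrite tmapr_id // (tmapr_comp (h := \0)) => [|a]; last by rewrite /= gzc.
    by rewrite tmapr_0 // subr0.
  rewrite linearB /= (tmapr_comp (h := \0)) => [|r]; last by rewrite /= glam.
  rewrite tmapr_0 // (tmapr_comp (h := idfun)) => [|a]; last by rewrite /= gzc.
  by rewrite tmapr_id // sub0r opprK.
split; first by exists psi.
move=> n m; split.
  case: m => t u [/= tn un]; rewrite /phi2 -scaleN1r.
  apply: tens_degD.
    apply: tmapr_deg tn => j r rj.
    exact: clambda_deg (alphaz_deg rj).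
  rewrite scaleN1r -linearN; case: n un {tn} => [/= ->|n] /=.
    by rewrite oppr0 linear0; exact: tens_deg0.
  elim/tens_deg_ind => {u} [|u v IHu IHv|i j x a ij xi aj].
  - by rewrite oppr0 linear0; exact: tens_deg0.
  - by rewrite opprD linearD; exact: tens_degD.
  rewrite -scaleN1r tens_scale_pure tmapr_pure.
  case: aj => [j1|->]; last by rewrite linear0 tpure_0r; exact: tens_deg0.
  (* The commutator [z, a] has degree 2, one more than a, which absorbs the shift. *)
  rewrite -ij j1 -addnS; apply: tens_deg_pure; last exact: zcomm_deg.
  by rewrite scaleN1r -sub0r; apply: cdegB => //; exact: cdeg0.
suff psi_deg w : tens_deg degD (@tsub_deg S D1 RD) n w -> prod_deg
    (tens_deg degD (@tsub_deg S V R))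
    (shift_deg (tens_deg degD (@conc_deg V 1))) n (psi w) by move=> /psi_deg; rewrite phiK.
move=> wn; split.
  apply: tmapr_deg wn => j {}w wj.
  by have [] := @RD_of_deg j (g w).1 (g w).2; rewrite -?surjective_pairing ?gK.
elim/tens_deg_ind: wn => {w} [|w v IHw IHv|i j x w ij xi wj] /=.
- by rewrite linear0 oppr0; case: n => [//|n]; exact: tens_deg0.
- rewrite linearD opprD; case: n IHw IHv => [/= -> ->|n]; first exact: addr0.
  exact: tens_degD.
have [_ [j2|w0]] : tdeg j (val (g w).1) /\ (j = 2%N \/ (g w).2 = 0).
    by apply: RD_of_deg; rewrite -surjective_pairing gK.
  rewrite tmapr_pure -scaleN1r tens_scale_pure.
  rewrite -ij j2 !addnS addn0 /= -[i.+1]addn1.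
  apply: tens_deg_pure; last by left.
  by rewrite scaleN1r -sub0r; apply: cdegB => //; exact: cdeg0.
rewrite tmapr_pure /= w0 tpure_0r oppr0; case: n ij => [//|n] _.
exact: tens_deg0.
Qed.

(** * Compatibility of [phi1] and [phi2] with the differentials *)

Fact cpi_sc s : cpi (tsc s) = cext_unit alpha s.
Proof. exact: (trmap_sc (sbm_incl D1)). Qed.

Lemma cpi_gen (d : D1) : cpi (tgen d) = val d.
Proof. exact: (trmap_gen (sbm_incl D1)). Qed.

Lemma cpi_czeta t : cpi (czeta t) = cproj t%:P.
Proof.
elim/tring_ind: t => [|x y IHx IHy|s|x v IHx].
- by rewrite !rmorph0.
- by rewrite !rmorphD /= IHx IHy.
- by rewrite -/(tsc s) czeta_sc cpi_sc.
- rewrite -mul_tgen !rmorphM /= IHx; congr (_ * _).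
  by rewrite [czeta _]trmap_gen; exact: cpi_gen.
Qed.

(** Checked on monomials: coefficients stand to the left of the powers of z on both sides, so
    nothing has to be commuted. *)
Lemma cpi_clambda p : cpi (clambda p) = cproj p.
Proof.
rewrite clambdaE rmorph_sum -[in RHS](coefK p) poly_def rmorph_sum.
apply: eq_bigr => i _.
rewrite rmorphM rmorphXn /= cpi_czeta [cpi _]cpi_gen -mul_polyC rmorphM.
by congr (_ * _); symmetry; exact: rmorphXn.
Qed.

(** The formula of [d2'] for arbitrary [w] in [TD] instead of [RD]; the degree-0 part of [w]
    contributes nothing. *)
Definition dform (x : Dreg) (w : TD) : tens Dreg D1 :=
  tlift (fun (t : TD) (y : D1) => tpure ((x : D) * cpi t : Dreg) y) (tdelta w).

Lemma dform_inner (x : Dreg) :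
  balanced (fun (t : TD) (y : D1) => tpure ((x : D) * cpi t : Dreg) y).
Proof. exact: (dformula_inner cpi_sc x). Qed.

Lemma dform_sn x d w : dform x (tsnoc d w) = tpure ((x : D) * cpi w : Dreg) d.
Proof. by rewrite /dform tdelta_snoc tlift_pure //; exact: dform_inner. Qed.

Lemma dform_balanced : balanced dform.
Proof.
have bal := dformula_bal cpi_sc.
split=> [v y z|y v w|y s v]; [exact: (balDl bal)|exact: (balDr bal)|].
exact: (balA bal).
Qed.

Lemma dformD x : {morph dform x : w w' / w + w'}.
Proof. exact: balDr dform_balanced x. Qed.

Lemma dform0 x : dform x 0 = 0.
Proof. by apply: (addrI (dform x 0)); rewrite -dformD !addr0. Qed.

Lemma dform_scr x s : dform x (tsc s) = 0.
Proof.
rewrite /dform tdelta_sc; apply: tlift_nil.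
exact: dform_inner.
Qed.

Lemma d1'_balanced :
  balanced (fun (x : Dreg) (y : D1) => (x : D) * (val y : D) : Dreg).
Proof.
split=> [v x x'|x v w|x s v]; [exact: mulrDl|exact: mulrDr|].
by symmetry; exact: mulrA.
Qed.

Lemma d1'D : {morph @d1' S V R alpha : t u / t + u}.
Proof. exact: tliftD d1'_balanced. Qed.

Lemma d2'_balanced : balanced (fun (x : Dreg) (r : RD) => dform x (val r)).
Proof.
have [Dl Dr A] := dform_balanced.
by split=> [r x y|x r r'|x s r]; [exact: Dl|exact: Dr|exact: A].
Qed.

Lemma d2'D : {morph @d2' S V R alpha : t u / t + u}.
Proof. exact: tliftD d2'_balanced. Qed.

Lemma cproj_X_comm (x : Dreg) : (x : D) * cproj 'X = cproj 'X * (x : D).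
Proof.
have [p <-] : exists p, cproj p = x by exists (repr (x : D)); exact: rqpiK.
by rewrite -!rmorphM [p * _]commr_polyX.
Qed.

Lemma phi1_d1' m : d1' (phi1 m) = delta1 m.
Proof.
case: m => t y; rewrite /phi1 /delta1 /= d1'D; congr (_ + _).
  rewrite [t in LHS]tens_sum linear_sum /=.
  have d1'0 : d1' (0 : tens Dreg D1) = 0 :> Dreg.
    exact: tlift_nil d1'_balanced.
  rewrite (big_morph _ d1'D d1'0); apply: eq_bigr => p _.
  by rewrite tmapr_pure d1'_pure.
by rewrite d1'_pure; exact: cproj_X_comm.
Qed.

Lemma dform_czeta (x : Dreg) t : dform x (czeta t) = tmapr cgen
  (tlift (fun (t : T) (a : V) => tpure ((x : D) * cpizeta alpha t : Dreg) a)
         (tdelta t)).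
Proof.
pose b (t : T) (a : V) : tens Dreg V :=
  tpure ((x : D) * cpizeta alpha t : Dreg) a.
have bb : balanced b by exact: (dformula_inner (@cpizeta_sc S V R alpha) x).
rewrite -/b; elim/tring_ind: t => [|w w' IH IH'|s|w v _].
- by rewrite rmorph0 dform0 tdelta0 (tlift_nil bb) linear0.
- by rewrite rmorphD dformD tdeltaD (tliftD bb) IH IH' -linearD.
- by rewrite -/(tsc s) czeta_sc dform_scr tdelta_sc (tlift_nil bb) linear0.
- rewrite tdelta_snoc (tlift_pure _ _ bb) tmapr_pure -mul_tgen rmorphM.
  by rewrite [X in _ * X]trmap_gen [X in dform x X]mul_tgen dform_sn.
Qed.

(** The term i = 0 of [clambda (alphaz r)] is [czeta r] and gives [partial2]. Every other term ends
    in z, and removing one z leaves the corresponding term of [f2], whence the exponent i - 1. *)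
Lemma d2'_lamR x (r : R) : d2' (tpure x (lamR r)) =
  tmapr cgen (partial2 (tpure x r : tens Dreg R)) + tpure (f2 (tpure x r)) cz.
Proof.
pose N := Defs.tsize (val r).
(* One term more than necessary, so that i = 0 can be split off even when r = 0. *)
have sz : (size (alphaz alpha r) <= N.+1)%N by rewrite leqW // size_poly.
rewrite d2'_pure partial2_pure -dform_czeta -/(dform x _) /= (clambda_widen sz).
rewrite big_ord_recl expr0 mulr1 coef_alphaz dformD; congr (_ + _).
rewrite f2_pure (f2_widen _ (leqnSn _)) big_add1 big_mkord.
have bp := balanced_tpure Dreg D1.
rewrite (big_morph (fun y : Dreg => tpure y cz) (balDl bp cz) (tpure_0l _ _)).
rewrite (big_morph _ (dformD x) (dform0 x)); apply: eq_bigr => i _ /=.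
rewrite exprSr mulrA mul_tgen dform_sn coef_alphaz rmorphM rmorphXn /=.
by rewrite cpi_gen mulrA.
Qed.

Lemma d2'_zcomR x a : d2' (tpure x (zcomR a)) =
  tpure (cproj 'X *: x) (cgen a) - tpure ((x : D) * val (cgen a) : Dreg) cz.
Proof.
rewrite d2'_pure -/(dform x _) /= /zcomm !mul_tgen.
have FN w : dform x (- w) = - dform x w.
  by apply: (addrI (dform x w)); rewrite -dformD !subrr dform0.
by rewrite dformD FN !dform_sn !cpi_gen cproj_X_comm.
Qed.

Lemma phi1B : {morph phi1 : m m' / m - m'}.
Proof. exact: linearB. Qed.

Lemma phi2_d2' m : d2' (phi2 m) = phi1 (delta2 m).
Proof.
have d2'0 : d2' (0 : tens Dreg RD) = 0 by exact: tlift_nil d2'_balanced.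
have d2'B : {morph @d2' S V R alpha : t u / t - u}.
  by move=> t u; apply: (addIr (d2' u)); rewrite -d2'D !subrK.
case: m => t u; rewrite /phi2 d2'B /delta2 /=.
have -> : d2' (tmapr lamR t) = phi1 (partial2 t, f2 t).
  rewrite {1}[t]tens_sum linear_sum /= (big_morph _ d2'D d2'0).
  have -> : (partial2 t, f2 t) = \sum_(p <- repr t)
      (partial2 (tpure p.1 p.2 : tens Dreg R),
       f2 (tpure p.1 p.2 : tens Dreg R)).
    apply: injective_projections; rewrite /= (raddf_sum fst, raddf_sum snd).
      by apply: eq_bigr => p _; rewrite /= partial2_pure.
    by apply: eq_bigr => p _; rewrite /= f2_pure.
  by rewrite linear_sum; apply: eq_bigr => p _; rewrite tmapr_pure d2'_lamR.
have -> : d2' (tmapr zcomR u) = phi1 (cproj 'X *: u, - partial1 u).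
  rewrite {1}[u]tens_sum linear_sum /= (big_morph _ d2'D d2'0).
  have -> : (cproj 'X *: u, - partial1 u) = \sum_(p <- repr u)
      (cproj 'X *: tpure p.1 p.2, - partial1 (tpure p.1 p.2 : tens Dreg V)).
    apply: injective_projections; rewrite /= (raddf_sum fst, raddf_sum snd).
      by rewrite {1}[u]tens_sum scaler_sumr.
    rewrite -sumrN; apply: eq_bigr => p _; congr (- _).
    by rewrite partial1_pure.
  rewrite linear_sum; apply: eq_bigr => p _.
  rewrite tmapr_pure d2'_zcomR -[RHS]/(phi1 (_, _)) /phi1 /=.
  rewrite tens_scale_pure tmapr_pure.
  by rewrite partial1_pure (balN _ _ (balanced_tpure _ _)).
rewrite -phi1B; congr (phi1 _).
by apply: injective_projections => //=; rewrite opprK addrC.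
Qed.

(** * Degree-0 terms, and relations under [cpi] *)

Lemma cext_unit_coef0 (w : TD) : w 0%N = 0 -> cext_unit alpha (w 0%N) = 0.
Proof. by move=> ->; exact: (rmorph0 (cext_unit alpha)). Qed.

(** Multiplying the last factor back on restores [w] up to its degree-0 part, which [tdelta]
    drops. *)
Lemma d1'_dform x w :
  d1' (dform x w) = (x : D) * (cpi w - cext_unit alpha (w 0%N)) :> D.
Proof.
elim/tring_ind: w => [|w w' IH IH'|s|w v _].
- rewrite dform0 [LHS](tlift_nil d1'_balanced) !rmorph0.
  by rewrite subr0 mulr0.
- rewrite dformD d1'D [LHS](congr2 +%R IH IH') -mulrDr rmorphD tcoefD.
  by rewrite [cext_unit _ (_ + _)](rmorphD (cext_unit alpha)) opprD addrACA.
- rewrite -/(tsc s) dform_scr [LHS](tlift_nil d1'_balanced) cpi_sc.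
  by rewrite [tsc s 0%N](@tin_id S D1 0) subrr mulr0.
- rewrite dform_sn d1'_pure cext_unit_coef0 // -mul_tgen rmorphM /= cpi_gen.
  by rewrite subr0 mulrA.
Qed.

(** The first summand maps to the class of an element of [Pz]; the commutator vanishes because z is
    central in [D]. *)
Lemma cpi_RD (r : RD) : cpi (val r) = 0.
Proof.
have [_ [_ [[_ [r' _ <-] <-] [a _ <-] ->]]] := sbm_mem r.
rewrite rmorphD cpi_clambda rmorphB !rmorphM /= !cpi_gen.
rewrite cproj_X_comm subrr addr0.
rewrite -(rmorph0 cproj); apply/rqpiP; rewrite subr0.
exists [:: (1, alphaz alpha r', 1)]; last by rewrite big_seq1 mul1r mulr1.
by move=> p; rewrite inE => /eqP ->; exists r'.
Qed.

Lemma czeta_coef0 t : czeta t 0%N = t 0%N :> S.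
Proof.
elim/tring_ind: t => [|w w' IH IH'|s|w v _].
- by rewrite rmorph0.
- by rewrite rmorphD !tcoefD; congr (_ + _).
- by rewrite -/(tsc s) czeta_sc [LHS](@tin_id S D1 0) [RHS](@tin_id S V 0).
- by rewrite -mul_tgen rmorphM [X in _ * X]trmap_gen !mul_tgen.
Qed.

Lemma clambdaMX p : clambda (p * 'X) = clambda p * tgen cz.
Proof. by rewrite /clambda rmorphM /= map_polyX hornerMX. Qed.
Lemma clambdaC c : clambda c%:P = czeta c.
Proof. by rewrite /clambda map_polyC hornerC. Qed.
Lemma clambdaD p q : clambda (p + q) = clambda p + clambda q.
Proof. by rewrite /clambda rmorphD hornerD. Qed.

Lemma RD_coef0 (r : RD) : (val r : TD) 0%N = 0.
Proof.
have clambda_coef0 p : clambda p 0%N = p`_0 0%N :> S.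
  elim/poly_ind: p => [|p c _]; first by rewrite clambdaC czeta_coef0 coefC.
  rewrite clambdaD clambdaMX clambdaC mul_tgen tcoefD add0r czeta_coef0.
  by rewrite coefD coefMX coefC add0r.
have [_ [_ [[_ [r' _ <-] <-] [a _ <-] ->]]] := sbm_mem r.
rewrite tcoefD clambda_coef0 coef_alphaz [alpha_ _ _ _]/(val r').
rewrite (R_ge2 r').1 add0r.
by rewrite /zcomm !mul_tgen tcoefB subr0.
Qed.

(** * The kernel of [cpi] is the ideal generated by [RD] *)

Local Notation RDset := (@RD_set S V R alpha).
Local Notation qpi := (rqpi RDset).

Lemma RDset_ideal w : RDset w -> ideal_gen RDset w.
Proof.
move=> wR; exists [:: (1, w, 1)]; last by rewrite big_seq1 mul1r mulr1.
by move=> p; rewrite inE => /eqP ->.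
Qed.

(** It suffices to commute z with the generators in [A^1], and their commutators with z lie in
    [RD]. *)
Lemma qpi_cz_comm t : qpi (tgen cz * czeta t) = qpi (czeta t * tgen cz).
Proof.
elim/tring_ind: t => [|w w' IH IH'|s|w v IH].
- by rewrite rmorph0 mulr0 mul0r.
- by rewrite rmorphD mulrDr mulrDl !(rmorphD qpi) /= IH IH'.
- by rewrite -/(tsc s) czeta_sc tsc_cz.
- rewrite -mul_tgen (rmorphM czeta) mulrA (rmorphM qpi) /= IH.
  rewrite [czeta (tgen v)]trmap_gen.
  rewrite -(rmorphM qpi) -!mulrA !(rmorphM qpi (czeta w)); congr (_ * _).
  apply/rqpiP/RDset_ideal; exact: (sbm_mem (zcomR v)).
Qed.

Lemma qpi_clambdaM p q :
  qpi (clambda (p * q)) = qpi (clambda p) * qpi (clambda q).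
Proof.
(* Constants first: c has to move past the powers of z in [clambda r], which [qpi_cz_comm]
   allows. *)
have MC (r : {poly T}) c : qpi (clambda (r * c%:P)) = qpi (clambda r * czeta c).
  elim/poly_ind: r => [|r d IH].
    by rewrite mul0r clambdaC rmorph0 mul0r.
  have -> : (r * 'X + d%:P) * c%:P = (r * c%:P) * 'X + (d * c)%:P.
    by rewrite mulrDl -mulrA -commr_polyX mulrA polyCM.
  rewrite !clambdaD !clambdaMX !clambdaC mulrDl !(rmorphD qpi) (rmorphM czeta).
  congr (_ + _); rewrite (rmorphM qpi) /= IH -(rmorphM qpi) -!mulrA.
  by rewrite !(rmorphM qpi (clambda r)) /= qpi_cz_comm.
rewrite -(rmorphM qpi); elim/poly_ind: q => [|q c IH].
  by rewrite mulr0 clambdaC rmorph0 mulr0.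
rewrite mulrDr !clambdaD mulrDr !(rmorphD qpi) /= MC clambdaC; congr (_ + _).
by rewrite mulrA !clambdaMX mulrA (rmorphM qpi) /= IH -(rmorphM qpi).
Qed.

(** Modulo the ideal, every word in [D1] can be reordered with its powers of z on the right, which
    is the form of a value of [clambda]. *)
Lemma cpi_lift w : exists p, cproj p = cpi w /\ qpi w = qpi (clambda p).
Proof.
elim/tring_ind: w => [|w w' [p [pw wp]] [p' [pw' wp']]|s|w d [p [pw wp]]].
- by exists 0; rewrite clambdaC !rmorph0.
- by exists (p + p'); rewrite clambdaD !rmorphD /= pw pw' wp wp'.
- by exists (tsc s)%:P; rewrite clambdaC czeta_sc -/(tsc s) cpi_sc.
have [u ud] := D1_of_surj d.
(* The new letter d is a + s z, so p is multiplied by this linear polynomial. *)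
exists (p * ((tgen u.1)%:P + (tsc u.2)%:P * 'X)); split.
  rewrite -mul_tgen !rmorphM /= pw cpi_gen -ud.
  by rewrite [X in _ = _ * X]val_D1_of.
rewrite -mul_tgen (rmorphM qpi) /= wp qpi_clambdaM; congr (_ * qpi _).
rewrite clambdaD clambdaMX !clambdaC czeta_sc [czeta _]trmap_gen -ud.
by rewrite /D1_of (linearD (tgen_hom D1)) (linearZZ (tgen_hom D1)).
Qed.

(** Here w is congruent to [clambda p] with p in the ideal of [Pz]; being multiplicative modulo
    [RD], [clambda] sends p to zero there, since [clambda] maps [Pz] into [RD]. *)
Lemma ker_cpi w : cpi w = 0 -> ideal_gen RDset w.
Proof.
move=> w0; have [p [pw wp]] := cpi_lift w.
have : ideal_gen Pz p.
  rewrite -[p]subr0; apply/rqpiP; rewrite [LHS]pw w0; symmetry; exact: rmorph0.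
move=> [s sP pE]; rewrite -[w]subr0; apply/rqpiP; rewrite wp pE.
have sumL : {morph (fun p => qpi (clambda p)) : p q / p + q}.
  by move=> q q'; rewrite clambdaD rmorphD.
have L0 : qpi (clambda 0) = qpi 0 by rewrite clambdaC rmorph0.
rewrite (big_morph _ sumL L0) big_seq (rmorph0 qpi) big1 // => q /sP[r _ qr].
rewrite !qpi_clambdaM -qr (_ : qpi (clambda (alphaz _ r)) = 0) ?mulr0 ?mul0r //.
rewrite -(rmorph0 qpi); apply/rqpiP; rewrite subr0; apply: RDset_ideal.
exact: (sbm_mem (lamR r)).
Qed.

(** * Exactness at [D (x) D^1] *)

Lemma d1'_d2' u : d1' (d2' u) = 0 :> D.
Proof.
elim/tens_ind: u => [|u v IHu IHv|x r].
- by rewrite [d2' 0](tlift_nil d2'_balanced) [LHS](tlift_nil d1'_balanced).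
- by rewrite d2'D d1'D [LHS](congr2 +%R IHu IHv) addr0.
- rewrite d2'_pure -/(dform x (val r)) d1'_dform cpi_RD.
  by rewrite cext_unit_coef0 ?RD_coef0 // subr0 mulr0.
Qed.

Lemma dformM (a w : TD) : w 0%N = 0 -> dform 1 (a * w) = dform (cpi a : D) w.
Proof.
move=> w0.
(* The induction on w passes through degree 0, so the claim is generalized to all w with a
   correction for the degree-0 part. *)
suff -> : dform 1 (a * w) =
    dform (cpi a : D) w + dform 1 (a :* (w 0%N : S)).
  by rewrite w0 rscale0r dform0 addr0.
elim/tring_ind: {w0}w => [|w w' IH IH'|s|w v _].
- by rewrite mulr0 tcoef0 rscale0r !dform0 addr0.
- by rewrite mulrDr !dformD IH IH' tcoefD rscaleDr dformD addrACA.
- by rewrite -/(tsc s) dform_scr tsc_mul [tsc s 0%N](@tin_id S D1 0) add0r.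
- rewrite -mul_tgen mulrA !mul_tgen !dform_sn rscale0r dform0 addr0 mul1r.
  by rewrite rmorphM.
Qed.

Lemma d2'_exact t : d1' t = 0 :> D -> exists u, d2' u = t.
Proof.
have [w [w0 <-]] : exists w : TD, w 0%N = 0 /\ dform 1 w = t.
  elim/tens_ind: t => [|t u [w [w0 <-]] [w' [w0' <-]]|x d].
  - by exists 0; rewrite dform0.
  - by exists (w + w'); rewrite tcoefD w0 w0' addr0 dformD.
  (* A polynomial representing x, carried to [TD] by [clambda], lifts x along [cpi]. *)
  exists (tsnoc d (clambda (repr (x : D)))); split=> //.
  rewrite dform_sn cpi_clambda mul1r; congr tpure; exact: rqpiK.
rewrite d1'_dform cext_unit_coef0 // subr0 mul1r.
move=> /ker_cpi[s sP ->]; rewrite big_seq.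
elim/big_ind: _ => [|v v'|[[a r] b] /sP].
- by exists 0; rewrite dform0 [LHS](tlift_nil d2'_balanced).
- by move=> [u uE] [u' uE']; exists (u + u'); rewrite d2'D dformD uE uE'.
move=> /= rR; pose r' : RD := @sbm_elt _ _ _ RD r rR.
(* For a scalar b the product r b stays in [RD] and yields a value of [d2']. If b ends in a letter,
   removing that letter leaves a multiple of r, which [cpi] kills. *)
elim/tring_ind: b => [|b b' [u uE] [u' uE']|c|b d _].
- by exists 0; rewrite mulr0 dform0 [LHS](tlift_nil d2'_balanced).
- by exists (u + u'); rewrite d2'D mulrDr dformD uE uE'.
- exists (tpure (cpi a : Dreg) (r' :* c)); rewrite d2'_pure -/(dform _ _).
  by rewrite -dformM ?RD_coef0 //= -/(tsc c) -mulrA tsc_mul.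
- exists 0; rewrite [LHS](tlift_nil d2'_balanced) -mul_tgen mulrA mul_tgen.
  by rewrite dform_sn !rmorphM [cpi r](cpi_RD r') mulr0 mul0r mulr0 tpure_0l.
Qed.

Lemma M_seq_iso : augseq_iso (M_seq alpha) (RD_seq alpha).
Proof.
exists (phi2 : {linear _ -> _}), (phi1 : {linear _ -> _}),
  (idfun : {linear Dreg -> Dreg}).
split; split.
- exact: phi2_iso.
- exact: phi1_iso.
- by split=> //; exists id.
- exact: phi2_d2'.
- exact: phi1_d1'.
- by [].
Qed.

Lemma RD_seq_H1 : H1_zero (RD_seq alpha).
Proof.
apply/seteqP; split=> t /=; first by move/d2'_exact => [u <-]; exists u.
by move=> [u _ <-]; exact: d1'_d2'.
Qed.
End CentralExtension.

(** * Transfer to [M_seq] *)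

Lemma augseq_iso_H1 (B : pzRingType) (S : Type) (C C' : augseq B S) :
  augseq_iso C C' -> H1_zero C' -> H1_zero C.
Proof.
move=> [phi2 [phi1 [phi0 [[[bij2 _] [bij1 _] [bij0 _]] [c2 c1 _]]]]] exC'.
have [g2 _ g2K] := bij2; have inj1 := bij_inj bij1; have inj0 := bij_inj bij0.
apply/seteqP; split=> x /=.
  move=> dx; have : range (@as_d2 _ _ C') (phi1 x).
    by rewrite -exC' /= c1 dx linear0.
  by move=> [y _ yx]; exists (g2 y) => //; apply: inj1; rewrite -c2 g2K.
move=> [y _ <-]; apply: inj0; rewrite -c1 -c2 linear0.
have : range (@as_d2 _ _ C') (as_d2 (phi2 y)) by exists (phi2 y).
by rewrite -exC'.
Qed.

(** As [R] is graded, the components of r again lie in the kernel of [tpi]. In degree 0 this map is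
    the injective unit, in degree 1 the inclusion of [A^1], so both components vanish. *)
Lemma relations_deg_ge2 (S : nzRingType) (A : grsring S)
    (R : gsubbimod (gcomp A 1)) :
  connected A -> bimodule_of_relations R -> rels_deg_ge2 R.
Proof.
move=> [unit_inj _] [RI _ _] r.
have Rn n : tpi (tin n ((val r : tring (gcomp A 1)) n)) = 0.
  exact: (RI _ (@gsb_hom _ _ R n _ (sbm_mem r))).
split.
  apply: unit_inj; rewrite rmorph0 -[RHS](Rn 0%N); symmetry.
  exact: (trmap_sc (sbm_incl (gcomp A 1))).
rewrite -[LHS]tin_id tpow1_valK.
have -> : tpow1_val ((val r : tring (gcomp A 1)) 1%N) = 0.
  apply: val_inj; rewrite -[RHS](Rn 1%N) tpow1_valK; symmetry.
  exact: (trmap_gen (sbm_incl (gcomp A 1))).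
by rewrite (linear0 (tgen_hom (gcomp A 1))).
Qed.

Theorem theorem4p14 (S : nzRingType) (A : grsring S)
  (R : gsubbimod (gcomp A 1)) (alpha : filtered_map R)
  (A_connected : connected A) (A_strong : strongly_graded A)
  (R_rel : bimodule_of_relations R)
  (A1_projective : projective (gcomp A 1)) (R_projective : projective R) :
  augseq_iso (M_seq alpha) (RD_seq alpha) /\ H1_zero (M_seq alpha).
Proof.
have R_ge2 := relations_deg_ge2 A_connected R_rel.
have iso := M_seq_iso alpha R_ge2.
by split=> //; exact: augseq_iso_H1 iso (RD_seq_H1 alpha R_ge2).
Qed.
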